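(* Let $K$ be a local field and let $S\subset\mathbb{P}^3$ be a smooth cubic surface over $K$. Then the following hold. (i) The group $H_S^0(K)$ is finite. (ii) The natural map $S(K) \rightarrow H_S(K)$ given by $P \mapsto [P]$ is locally constant, where $S(K)$ has the topology induced by $K$.
   Context: Here a local field means $K=\mathbb{R}$ or $\mathbb{C}$, or a finite extension of $\mathbb{Q}_p$ for some prime $p$. A $K$-line is a line $\ell \subset \mathbb{P}^3$ defined over $K$. If $\ell \not\subset S$ is a $K$-line, then $\ell\cdot S = P+Q+R$ denotes the intersection of $\ell$ with $S$ counted with multiplicity. Let $G_S(K)=\bigoplus_{P\in S(K)}\mathbb{Z}\cdot P$ be the free abelian group on $S(K)$. Let $G'_S(K)$ be the subgroup generated by all sums $P+Q+R$ with $P,Q,R\in S(K)$ (not necessarily distinct) such that (i) there is a $K$-line $\ell$ not contained in $S$ with $\ell\cdot S=P+Q+R$, or (ii) there is a $K$-line $\ell$ contained in $S$ with $P,Q,R\in\ell$. Let $\deg:G_S(K)\to\mathbb{Z}$, $\deg(\sum a_iP_i)=\sum a_i$, let $G''_S(K)=\{D\in G'_S(K):\deg(D)=0\}$, and $H_S(K)=G_S(K)/G''_S(K)$. The image of $P\in S(K)$ in $H_S(K)$ is denoted $[P]$. The degree map descends to $\deg:H_S(K)\to\mathbb{Z}$, and $H^0_S(K)=\{D\in H_S(K):\deg(D)=0\}$. *)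

(* Defs.v *)
From HB Require Import structures.
From mathcomp Require Import all_boot all_order all_algebra all_field.
From mathcomp Require Import freeg mpoly.
From mathcomp Require Import boolp classical_sets cardinality reals topology.
From mathcomp Require Import complex.

Set Implicit Arguments.
Unset Strict Implicit.
Unset Printing Implicit Defensive.

Import Order.TTheory GRing.Theory Num.Theory.
Local Open Scope classical_set_scope.
Local Open Scope quotient_scope.
Local Open Scope ring_scope.

(* A field with a topology on its carrier; no compatibility between the two
   is built in (for local fields it comes from [local_field]). *)
#[short(type="preTopologicalFieldType")]
HB.structure Definition PreTopologicalField :=
  {K of GRing.Field K & Topological K}.

Section LocalFields.
Variable R : realType.

Record absolute_value (K : fieldType) (abv : K -> R) : Prop := AbsoluteValue {
  abv_ge0 : forall x, 0 <= abv x;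
  abv_eq0 : forall x, abv x = 0 <-> x = 0;
  abvM : forall x y, abv (x * y) = abv x * abv y;
  abv_triangle : forall x y, abv (x + y) <= abv x + abv y }.

Definition abv_complete (K : fieldType) (abv : K -> R) : Prop :=
  forall u : nat -> K,
    (forall e : R, 0 < e ->
       exists N, forall m n, (N <= m)%N -> (N <= n)%N -> abv (u m - u n) < e) ->
    exists l, forall e : R, 0 < e ->
      exists N, forall n, (N <= n)%N -> abv (u n - l) < e.

(* |q|_p = p ^ (- v_p(q)), with |p|_p = 1/p. *)
Definition padic_abv (p : nat) (q : rat) : R :=
  if q == 0 then 0
  else p%:R ^ ((logn p `|denq q|)%:Z - (logn p `|numq q|)%:Z).

(* (Qp, abv) is the field of p-adic numbers, i.e. the completion of the
   rationals for the p-adic absolute value (unique up to a unique isometric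
   isomorphism). *)
Record padic_completion (p : nat) (Qp : fieldType) (abv : Qp -> R) : Prop :=
  PadicCompletion {
    padic_absolute_value : absolute_value abv;
    padic_abv_ratr : forall q : rat, abv (ratr q) = padic_abv p q;
    padic_dense : forall (x : Qp) (e : R), 0 < e ->
      exists q : rat, abv (x - ratr q) < e;
    padic_complete : abv_complete abv }.

Definition abv_induces_topology (K : preTopologicalFieldType) (abv : K -> R) :
    Prop :=
  forall (x : K) (A : set K),
    nbhs x A <-> exists2 e : R, 0 < e & [set y | abv (x - y) < e] `<=` A.

Definition real_abv (K : fieldType) (abv : K -> R) : Prop :=
  exists2 f : {rmorphism R -> K}, bijective f &
    forall x : R, abv (f x) = `|x|.

Definition complex_abv (K : fieldType) (abv : K -> R) : Prop :=
  exists2 f : {rmorphism R[i] -> K}, bijective f &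
    forall z : R[i], (abv (f z))%:C%C = `|z|.

(* On a finite extension L of Qp, an absolute value extending the one of Qp
   exists and is unique, and it defines the topology of L. *)
Definition padic_extension_abv (K : fieldType) (abv : K -> R) : Prop :=
  exists p : nat, prime p /\
  exists (Qp : fieldType) (abvp : Qp -> R), padic_completion p abvp /\
  exists (L : fieldExtType Qp) (f : {rmorphism L -> K}), bijective f /\
    forall x : Qp, abv (f x%:A) = abvp x.

Definition local_field (K : preTopologicalFieldType) : Prop :=
  exists abv : K -> R,
    [/\ absolute_value abv, abv_induces_topology abv &
        [\/ real_abv abv, complex_abv abv | padic_extension_abv abv]].

End LocalFields.

Section ProjectiveSpace.
Variable K : preTopologicalFieldType.

Definition nonzero_vector : Type := [set v : 'rV[K]_4 | v != 0].
HB.instance Definition _ := Topological.on nonzero_vector.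

Definition proportional (u v : nonzero_vector) : bool :=
  `[< exists2 c : K, c != 0 & \val u = c *: \val v >].

Lemma proportional_equiv : equiv_class_of proportional.
Proof.
split=> [u|u v|v u w].
- by apply/asboolP; exists 1; rewrite ?oner_eq0 // scale1r.
- by apply/asboolP/asboolP => -[c c0 ->]; exists c^-1;
    rewrite ?invr_eq0 // scalerA mulVf // scale1r.
- move=> /asboolP[c c0 uE] /asboolP[d d0 vE]; apply/asboolP.
  by exists (c * d); rewrite ?mulf_neq0 // uE vE scalerA.
Qed.

Canonical proportional_equivRel := EquivRelPack proportional_equiv.
Canonical proportional_encModRel := defaultEncModRel proportional.

(* P^3(K) = (K^4 \ {0}) / K^*, with the quotient topology. *)
Definition proj3 : Type := quotient_topology {eq_quot proportional}.
HB.instance Definition _ := Topological.on proj3.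
HB.instance Definition _ := Quotient.on proj3.

(* Homogeneous coordinates, defined up to a nonzero scalar. *)
Definition coords (P : proj3) : 'rV[K]_4 := \val (repr P).

End ProjectiveSpace.

Section CubicSurface.
Variables (K : preTopologicalFieldType) (F : {mpoly K[4]}).

(* F = 0 defines a smooth cubic surface: F is a nonzero cubic form and, over
   every field extension of K (equivalently, over an algebraic closure), no
   point of F = 0 annihilates the gradient of F. *)
Definition smooth_cubic : Prop :=
  [/\ F \is 3.-homog for mdeg, F != 0 &
      forall (L : fieldType) (f : {rmorphism K -> L}) (x : 'I_4 -> L),
        (exists i, x i != 0) -> (map_mpoly f F).@[x] = 0 ->
        exists i, (map_mpoly f F^`M(i)).@[x] != 0].

Definition surface_points : Type :=
  [set P : proj3 K | F.@[coords P ord0] = 0].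
HB.instance Definition _ := Topological.on surface_points.

(* K-lines in P^3 are the 2-dimensional subspaces of K^4. *)
Definition on_line (l : {vspace 'rV[K]_4}) (P : proj3 K) : bool :=
  coords P \in l.

Definition restrict_line (v w : 'rV[K]_4) : {poly K} :=
  mmap (@polyC K) (fun i => (v ord0 i)%:P + w ord0 i *: 'X) F.

(* Scheme-theoretic inclusion of l in S: F(v + t w) is the zero polynomial in
   t for all v, w in l. *)
Definition line_in_surface (l : {vspace 'rV[K]_4}) : Prop :=
  forall v w, v \in l -> w \in l -> restrict_line v w = 0.

(* The intersection multiplicity of l and S at a point P of l, for l not
   contained in S: the order of vanishing at t = 0 of F(v + t w), where v
   represents P and (v, w) is a basis of l. *)
Definition intersection_mult (l : {vspace 'rV[K]_4}) (P : proj3 K) : nat :=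
  mup 0 (restrict_line (coords P) (vpick (l :\: <[coords P]>)%VS)).

(* l . S = P + Q + R. As l . S has degree 3, this equality may be tested on the
   K-points of l. *)
Definition line_cycle (l : {vspace 'rV[K]_4}) (P Q R : surface_points) : Prop :=
  [/\ on_line l (\val P), on_line l (\val Q), on_line l (\val R) &
      forall X : proj3 K, on_line l X ->
        intersection_mult l X =
          ((X == \val P) + (X == \val Q) + (X == \val R))%N].

Definition G_S : Type := {freeg surface_points}.
HB.instance Definition _ := GRing.Zmodule.on G_S.

Inductive line_relation : G_S -> Prop :=
| LineNotIn (l : {vspace 'rV[K]_4}) (P Q R : surface_points) :
    \dim l = 2%N -> ~ line_in_surface l -> line_cycle l P Q R ->
    line_relation (<< P >> + << Q >> + << R >>)
| LineIn (l : {vspace 'rV[K]_4}) (P Q R : surface_points) :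
    \dim l = 2%N -> line_in_surface l ->
    on_line l (\val P) -> on_line l (\val Q) -> on_line l (\val R) ->
    line_relation (<< P >> + << Q >> + << R >>).

Definition G_S' : set G_S :=
  smallest [set A : set G_S | GRing.zmod_closed [pred D | D \in A]] line_relation.

Definition G_S'' : {pred G_S} := [pred D | (D \in G_S') && (deg D == 0)].

Lemma G_S'_zmod_closed : GRing.zmod_closed [pred D | D \in G_S'].
Proof.
split=> [|D E /set_mem DG /set_mem EG]; apply/mem_set => A [Acl AG].
  by have [/set_mem] := Acl.
have [_ AB] := Acl; apply/set_mem/AB; apply/mem_set.
  by apply: DG; split.
by apply: EG; split.
Qed.

Lemma G_S''_zmod_closed : GRing.zmod_closed G_S''.
Proof.
have [G0 GB] := G_S'_zmod_closed.
split=> [|D E /andP[DG /eqP D0] /andP[EG /eqP E0]]; apply/andP; split.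
- exact: G0.
- by rewrite deg0.
- exact: GB.
- by rewrite degB D0 E0 subr0.
Qed.

HB.instance Definition _ := GRing.isZmodClosed.Build G_S G_S'' G_S''_zmod_closed.

Definition H_S : Type := Quotient.quot G_S''.
HB.instance Definition _ := GRing.Zmodule.on H_S.
HB.instance Definition _ := Quotient.on H_S.

Definition point_class (P : surface_points) : H_S := \pi_H_S (<< P >> : G_S).

Definition deg_H (x : H_S) : int := deg (repr x).

Lemma deg_H_pi (D : G_S) : deg_H (\pi_H_S D) = deg D.
Proof.
have : repr (\pi_H_S D) == D %[mod H_S] by rewrite reprK.
rewrite -Quotient.idealrBE => /andP[_]; rewrite degB subr_eq0 => /eqP.
by [].
Qed.

Definition H0_S : set H_S := [set x | deg_H x = 0].

End CubicSurface.

Arguments H0_S {K} F.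
Arguments point_class {K} F P.

Definition locally_constant (T : topologicalType) (U : Type) (f : T -> U) :
    Prop :=
  forall x : T, \forall y \near x, f y = f x.

(* Main.v *)
Require Import Defs.
From HB Require Import structures.
From mathcomp Require Import all_boot all_order all_algebra all_field.
From mathcomp Require Import freeg mpoly.
From mathcomp Require Import boolp classical_sets filter cardinality reals topology.
From mathcomp Require Import complex.
From mathcomp Require Import ring lra.

Set Implicit Arguments.
Unset Strict Implicit.
Unset Printing Implicit Defensive.

Import Order.TTheory GRing.Theory Num.Theory.
Local Open Scope classical_set_scope.
Local Open Scope quotient_scope.
Local Open Scope ring_scope.

(** Let F be the cubic form of S and T the symmetric trilinear form on K^4 with
   F(x) = T(x, x, x).  In terms of T the line through two points x, y of S meets
   S again at a x + b y, where a T(x, x, y) + b T(x, y, y) = 0; the tangent plane at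
   x is T(x, x, .) = 0; and if y lies in the tangent plane at x, then 2 [x] + [y] = h,
   where h is the common class of all line cycles.

   Local constancy at one point ([exists_locally_constant_point]).  Fix P in S(K).
   The tangent plane at P cuts S in a cubic curve that is singular at P, hence is
   parametrized by the slope t of the lines through P.  A point Q(t) of this curve
   satisfies 2 [P] + [Q(t)] = h, and a point x of the tangent plane at Q(t) satisfies
   2 [Q(t)] + [x] = h.  So [x] depends only on P for all x reached from P in two
   steps.  Given x, the condition on t is the polynomial equation
   T(Q(t), Q(t), x) = 0; if for x = x0 it has a simple root, then it has a root for
   every x near x0, by Newton's method ([simple_root_persists]).  A simple root
   exists for a suitable x0 unless the tangent plane of S is constant along the
   curve Q ([tangent_plane_varies_on_curve]).  In that case the curve is a line, and
   the gradient of F on this line is a binary quadratic form times a constant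
   vector; it vanishes at a point over a quadratic extension of K, against the
   smoothness of S ([tangent_plane_varies]).  All this needs a point P at which the
   second fundamental form is not zero; such a point is found near any given
   one ([exists_nonflat_point]).

   Local constancy everywhere ([cls_locally_constant_everywhere]).  Let u be a point
   near which the class is constant, not in the tangent plane at X, and V the third
   point of the line X u.  For X' near X the third point of the line X' V is near u,
   so [X'] = h - [V] - [u] is constant.  Such a u exists because an open piece of S
   is not contained in a plane ([near_point_off_plane]).

   Finiteness.  S(K) is compact, so the points have finitely many classes
   ([finitely_many_classes]).  If Q is the residual point of a tangent line at P,
   then 3 [Q] - h = - 2 (3 [P] - h).  Hence all the multiples of 3 [P] - h by powers of
   -2 lie in a finite set, and 3 [P] - h is torsion ([class_torsion]).  The degree zero
   part is therefore generated by finitely many torsion elements [P] - [P'].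

   The local fields enter through one statement, [local_field_locally_compact]: they
   have characteristic 0, arbitrarily small nonzero elements, and every bounded
   family has a limit along every ultrafilter. *)

(** * Limits along filters for an absolute value *)

Section AbsoluteValueTheory.
Variables (R : realType) (K : fieldType) (abv : K -> R).
Hypothesis abvP : absolute_value abv.

Lemma abv0 : abv 0 = 0.
Proof. exact/(abv_eq0 abvP). Qed.

Lemma abv_gt0 x : x != 0 -> 0 < abv x.
Proof.
move=> x0; rewrite lt_neqAle (abv_ge0 abvP) andbT eq_sym.
by apply: contraNneq x0 => /(abv_eq0 abvP) ->.
Qed.

Lemma abv1 : abv 1 = 1.
Proof.
have n0 : abv 1 != 0 by rewrite gt_eqF ?abv_gt0 ?oner_eq0.
by apply: (mulfI n0); rewrite -(abvM abvP) !mulr1.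
Qed.

Lemma abvN x : abv (- x) = abv x.
Proof.
have N1 : abv (- 1) = 1.
  have : abv (- 1) ^+ 2 = 1 by rewrite expr2 -(abvM abvP) mulrNN mulr1 abv1.
  by move/eqP; rewrite pexpr_eq1 ?(abv_ge0 abvP)// => /eqP.
by rewrite -mulN1r (abvM abvP) N1 mul1r.
Qed.

Lemma abv_distC x y : abv (x - y) = abv (y - x).
Proof. by rewrite -abvN opprB. Qed.

Lemma abv_sub_le x y z : abv (x - z) <= abv (x - y) + abv (y - z).
Proof. by rewrite -[x - z](subrKA y) (abv_triangle abvP). Qed.

Lemma abvX x n : abv (x ^+ n) = abv x ^+ n.
Proof. by elim: n => [|n IHn]; rewrite ?expr0 ?abv1// !exprS (abvM abvP) IHn. Qed.

Lemma abvV x : abv x^-1 = (abv x)^-1.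
Proof.
have [->|x0] := eqVneq x 0; first by rewrite invr0 abv0 invr0.
have n0 : abv x != 0 by rewrite gt_eqF ?abv_gt0.
by apply: (mulfI n0); rewrite -(abvM abvP) divff // abv1 divff.
Qed.

(** Convergence is phrased with the absolute value, since the p-adic numbers and
   their extensions come as fields without a topology. *)
Definition tends_to (T : Type) (F : set_system T) (f : T -> K) (l : K) : Prop :=
  forall e : R, 0 < e -> F [set x | abv (f x - l) < e].

Section Limits.
Variables (T : Type) (F : set_system T).
Context {FF : Filter F}.
Implicit Types (f g : T -> K) (l m : K).

Lemma tends_to_cst c : tends_to F (fun=> c) c.
Proof. by move=> e e0; apply: filterE => x /=; rewrite subrr abv0. Qed.

Lemma tends_to_eq f g l : f =1 g -> tends_to F f l -> tends_to F g l.
Proof. by move=> /funext ->. Qed.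

Lemma tends_toD f g l m :
  tends_to F f l -> tends_to F g m -> tends_to F (fun x => f x + g x) (l + m).
Proof.
move=> fl gm e e0; have e20 : 0 < e / 2 by rewrite divr_gt0.
apply: filterS2 (fl _ e20) (gm _ e20) => x /= fx gx.
rewrite opprD addrACA [e]splitr.
by apply: le_lt_trans (abv_triangle abvP _ _) _; exact: ltrD.
Qed.

Lemma tends_toM f g l m :
  tends_to F f l -> tends_to F g m -> tends_to F (fun x => f x * g x) (l * m).
Proof.
move=> fl gm e e0; set c := 1 + abv m + abv l.
have l0 := abv_ge0 abvP l; have m0 := abv_ge0 abvP m.
have c0 : 0 < c by rewrite /c; lra.
pose d := Num.min 1 (e / c).
have d0 : 0 < d by rewrite lt_min ltr01 divr_gt0.
have d1 : d <= 1 by rewrite ge_min lexx.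
have de : d * c <= e by rewrite -ler_pdivlMr // ge_min lexx orbT.
apply: filterS2 (fl _ d0) (gm _ d0) => x /= fx gx.
have -> : f x * g x - l * m = (f x - l) * (g x - m) + (f x - l) * m + l * (g x - m).
  by ring.
have := abv_triangle abvP ((f x - l) * (g x - m) + (f x - l) * m) (l * (g x - m)).
have := abv_triangle abvP ((f x - l) * (g x - m)) ((f x - l) * m).
rewrite !(abvM abvP).
have := abv_ge0 abvP (f x - l); have := abv_ge0 abvP (g x - m).
move: (abv (f x - l)) (abv (g x - m)) fx gx => u v ud vd v0 u0.
have uv : u * v < d by apply: le_lt_trans ud; rewrite ler_piMr // (le_trans (ltW vd)).
have : u * abv m <= d * abv m by rewrite ler_wpM2r // ltW.
have : abv l * v <= d * abv l by rewrite mulrC ler_wpM2r // ltW.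
move: de; rewrite /c; lra.
Qed.

Lemma tends_toN f l : tends_to F f l -> tends_to F (fun x => - f x) (- l).
Proof.
move=> fl e e0; apply: filterS (fl _ e0) => x /=.
by rewrite -opprD abvN.
Qed.

Lemma tends_toB f g l m :
  tends_to F f l -> tends_to F g m -> tends_to F (fun x => f x - g x) (l - m).
Proof. by move=> fl gm; apply: tends_toD => //; exact: tends_toN. Qed.

Lemma tends_toX f l n : tends_to F f l -> tends_to F (fun x => f x ^+ n) (l ^+ n).
Proof.
move=> fl; elim: n => [|n IHn]; first exact: tends_to_cst.
by rewrite exprS; apply: tends_to_eq (tends_toM fl IHn) => x; rewrite exprS.
Qed.

Lemma tends_toMn f l n : tends_to F f l -> tends_to F (fun x => f x *+ n) (l *+ n).
Proof.
move=> fl; elim: n => [|n IHn]; first exact: tends_to_cst.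
by rewrite mulrS; apply: tends_to_eq (tends_toD fl IHn) => x; rewrite mulrS.
Qed.

Lemma tends_to_sum (I : Type) (r : seq I) (f : I -> T -> K) (l : I -> K) :
  (forall i, tends_to F (f i) (l i)) ->
  tends_to F (fun x => \sum_(i <- r) f i x) (\sum_(i <- r) l i).
Proof.
move=> fl; elim: r => [|i r IHr].
  by rewrite big_nil; apply: tends_to_eq (tends_to_cst 0) => x; rewrite big_nil.
by rewrite big_cons; apply: tends_to_eq (tends_toD (fl i) IHr) => x; rewrite big_cons.
Qed.

Lemma tends_to_neq0 f l : tends_to F f l -> l != 0 -> F [set x | f x != 0].
Proof.
move=> fl l0; apply: filterS (fl _ (abv_gt0 l0)) => x /=; apply: contraTneq => ->.
by rewrite sub0r abvN ltxx.
Qed.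

Lemma tends_to_near f g l :
  F [set x | f x = g x] -> tends_to F f l -> tends_to F g l.
Proof. by move=> fg fl e e0; apply: filterS2 fg (fl _ e0) => x /= ->. Qed.

End Limits.

Lemma tends_to_unique (T : Type) (F : set_system T) {FF : ProperFilter F}
    (f : T -> K) (l m : K) : tends_to F f l -> tends_to F f m -> l = m.
Proof.
move=> fl fm; apply/eqP; rewrite -subr_eq0; apply/negPn/negP => lm.
have e0 : 0 < abv (l - m) / 2 by rewrite divr_gt0 // abv_gt0.
have [x [/= xl xm]] := filter_ex (filterI (fl _ e0) (fm _ e0)).
have := abv_sub_le l (f x) m; rewrite (abv_distC l (f x)); lra.
Qed.

Lemma tends_to_bound (T : Type) (F : set_system T) {FF : ProperFilter F}
    (f : T -> K) (l a : K) (r : R) :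
  tends_to F f l -> F [set x | abv (f x - a) <= r] -> abv (l - a) <= r.
Proof.
move=> fl fr; rewrite leNgt; apply/negP => rl.
have e0 : 0 < abv (l - a) - r by rewrite subr_gt0.
have [x [/= x1 x2]] := filter_ex (filterI (fl _ e0) fr).
have := abv_sub_le l (f x) a; rewrite (abv_distC l (f x)); lra.
Qed.

Lemma tends_to_comp (T U : Type) (F : set_system T) (G : set_system U)
    (p : U -> T) (f : T -> K) l :
  (forall A, F A -> G (p @^-1` A)) -> tends_to F f l -> tends_to G (f \o p) l.
Proof. by move=> pFG fl e /fl /pFG. Qed.

Lemma tends_to_fst (T U : Type) (F : set_system T) (G : set_system U)
    {FG : Filter G} (f : T -> K) l :
  tends_to F f l -> tends_to (filter_prod F G) (fun z => f z.1) l.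
Proof. by move=> fl; apply: (tends_to_comp (p := fst)) fl => A; exact: filter_prod1. Qed.

Lemma tends_to_snd (T U : Type) (F : set_system T) (G : set_system U)
    {FF : Filter F} (f : U -> K) l :
  tends_to G f l -> tends_to (filter_prod F G) (fun z => f z.2) l.
Proof. by move=> fl; apply: (tends_to_comp (p := snd)) fl => A; exact: filter_prod2. Qed.

Definition near_pt (a : K) : set_system K :=
  [set A | exists2 r : R, 0 < r & forall x, abv (x - a) < r -> A x].

Global Instance near_pt_filter a : Filter (near_pt a).
Proof.
split=> [|A B [r r0 rA] [s s0 sB]|A B AB [r r0 rA]]; first by exists 1.
- exists (Num.min r s) => [|x]; first by rewrite lt_min r0.
  by rewrite lt_min => /andP[/rA ? /sB].
- by exists r => // x /rA /AB.
Qed.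

Lemma near_pt_id a : tends_to (near_pt a) id a.
Proof. by move=> e e0; exists e. Qed.

Definition near_vec n (a : 'rV[K]_n) : set_system 'rV[K]_n :=
  [set A | exists2 r : R, 0 < r &
    forall x : 'rV[K]_n, (forall i, abv (x 0 i - a 0 i) < r) -> A x].

Global Instance near_vec_filter n (a : 'rV[K]_n) : Filter (near_vec a).
Proof.
split=> [|A B [r r0 rA] [s s0 sB]|A B AB [r r0 rA]]; first by exists 1.
- exists (Num.min r s) => [|x xrs]; first by rewrite lt_min r0.
  by split; [apply: rA|apply: sB] => i; have := xrs i; rewrite lt_min => /andP[].
- by exists r => // x /rA /AB.
Qed.

Lemma near_vec_coord n (a : 'rV[K]_n) i :
  tends_to (near_vec a) (fun x : 'rV_n => x 0 i) (a 0 i).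
Proof. by move=> e e0; exists e => // x xa; exact: xa. Qed.

Lemma near_vec_self n (a : 'rV[K]_n) (A : set 'rV[K]_n) : near_vec a A -> A a.
Proof. by case=> r r0; apply=> i; rewrite subrr abv0. Qed.

Lemma near_vec_near n (a : 'rV[K]_n) (A : set 'rV[K]_n) :
  near_vec a A -> near_vec a [set b | near_vec b A].
Proof.
case=> r r0 rA; exists (r / 2) => [|b ba]; first by rewrite divr_gt0.
exists (r / 2) => [|x xb]; first by rewrite divr_gt0.
apply: rA => i; rewrite [r]splitr.
by apply: le_lt_trans (abv_sub_le _ (b 0 i) _) _; rewrite ltrD.
Qed.

Lemma tends_to_near_vec (T : Type) (F : set_system T) {FF : Filter F} n
    (f : T -> 'rV[K]_n) (a : 'rV[K]_n) (A : set 'rV[K]_n) :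
  (forall i, tends_to F (fun x => f x 0 i) (a 0 i)) -> near_vec a A ->
  F [set x | A (f x)].
Proof.
move=> fa [r r0 rA]; apply: (@filterS _ _ _ [set x | forall i, abv (f x 0 i - a 0 i) < r]).
  by move=> x /= xr; exact: rA.
exact: (@filter_forall _ _ (fun i => [set x | abv (f x 0 i - a 0 i) < r])) (fun i => fa i r r0).
Qed.

(** Sequential compactness of bounded sets, in the form in which it passes to
   products without extracting subsequences. *)
Definition ultra_compact : Prop :=
  forall (T : Type) (U : set_system T), UltraFilter U ->
  forall (f : T -> K) (M : R), U [set x | abv (f x) <= M] ->
  exists l, tends_to U f l.

Record locally_compact_char0 : Prop := LocallyCompactChar0 {
  lc_abv : absolute_value abv;
  lc_compact : ultra_compact;
  lc_small : forall e : R, 0 < e -> exists2 x, x != 0 & abv x < e;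
  lc_natr : forall n, n.+1%:R != 0 :> K }.

End AbsoluteValueTheory.

(** * Compactness of bounded sets in R and in Q_p *)

Lemma ultra_finite_cover (T : Type) (U : set_system T) {UU : UltraFilter U}
    (I : eqType) (s : seq I) (A : set T) (B : I -> set T) :
  (forall x, A x -> exists2 i, i \in s & B i x) -> U A -> exists2 i, i \in s & U (B i).
Proof.
elim: s A => [|i s IHs] A AB UA; first by have [x /AB[]] := filter_ex UA.
have [UB|UnB] := in_ultra_setVsetC (B i) UU; first by exists i; rewrite ?mem_head.
have [|j js UBj] := IHs _ _ (filterI UA UnB).
  move=> x [/AB[j]]; rewrite inE => /predU1P[->//|js Bjx] _; by exists j.
by exists j => //; rewrite inE js orbT.
Qed.

Section RealLine.
Variable R : realType.

Lemma absolute_value_norm : absolute_value (fun x : R => `|x|).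
Proof.
split=> [//|x|x y|x y]; last 2 first.
- exact: normrM.
- exact: ler_normD.
by split=> [/normr0_eq0|->]; rewrite ?normr0.
Qed.

(** The limit is the supremum of the eventual lower bounds. *)
Lemma ultra_compact_real : ultra_compact (fun x : R => `|x|).
Proof.
move=> T U UU f M UM; pose S := [set a : R | U [set x | a <= f x]].
have SN : S (- M).
  by apply: filterS UM => x /=; rewrite ler_norml => /andP[].
have SM a : S a -> a <= M.
  move=> Sa; have [x /= [ax]] := filter_ex (filterI Sa UM).
  by rewrite ler_norml => /andP[_]; exact: le_trans.
have supS : has_sup S by split; [exists (- M)|exists M].
exists (sup S) => e e0.
have [a Sa la] := sup_adherent e0 supS.
have Ul : U [set x | f x < sup S + e].
  have [USe|] := in_ultra_setVsetC [set x | sup S + e <= f x] UU.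
    have : sup S + e <= sup S by exact: (ub_le_sup supS.2).
    by rewrite gerDl leNgt e0.
  by apply: filterS => x /= /negP; rewrite -ltNge.
apply: filterS2 Ul Sa => x /= x1 x2; rewrite ltr_norml; lra.
Qed.

Lemma locally_compact_real : locally_compact_char0 (fun x : R => `|x|).
Proof.
split=> [||e e0|n]; [exact: absolute_value_norm|exact: ultra_compact_real| |].
- exists (e / 2); first by rewrite gt_eqF ?divr_gt0.
  by rewrite gtr0_norm ?divr_gt0 //; lra.
- by rewrite pnatr_eq0.
Qed.

End RealLine.

Section PadicNumbers.
Variables (R : realType) (p : nat) (Qp : fieldType) (abv : Qp -> R).
Hypotheses (p_prime : prime p) (hQp : padic_completion p abv).
Let abvP := padic_absolute_value hQp.

Lemma padic_abvz (z : int) : z != 0 -> abv z%:~R = p%:R ^- logn p `|z|.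
Proof.
move=> z0; rewrite -ratr_int (padic_abv_ratr hQp) /padic_abv intr_eq0 (negPf z0).
by rewrite denq_int numq_int absz1 logn1 sub0r exprnN.
Qed.

Lemma padic_p_gt1 : 1 < p%:R :> R.
Proof. by rewrite ltr1n prime_gt1. Qed.

Lemma padic_abvz_le1 (z : int) : abv z%:~R <= 1.
Proof.
have [->|z0] := eqVneq z 0; first by rewrite (abv0 abvP) ler01.
by rewrite padic_abvz // invf_le1 ?exprn_ege1 ?exprn_gt0 // ?(lt_trans ltr01) ?padic_p_gt1 //
  ltW // padic_p_gt1.
Qed.

Lemma padic_abvp : abv p%:R = p%:R^-1.
Proof.
by rewrite pmulrn padic_abvz ?eqz_nat -?lt0n ?prime_gt0 // absz_nat logn_prime // eqxx expr1.
Qed.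

Lemma padic_intr (z : int) : z != 0 -> z%:~R != 0 :> Qp.
Proof.
move=> z0; apply/eqP => /(congr1 abv); rewrite padic_abvz // (abv0 abvP) => /eqP.
by rewrite invr_eq0 expf_eq0 pnatr_eq0 (gtn_eqF (prime_gt0 p_prime)) andbF.
Qed.

Lemma padic_natr n : n.+1%:R != 0 :> Qp.
Proof. by rewrite pmulrn padic_intr. Qed.

(** A rational number of absolute value at most 1 has a denominator prime to p,
   hence is congruent to an integer modulo every power of p. *)
Lemma padic_integral_approx (q : rat) n : padic_abv R p q <= 1 ->
  exists2 c : nat, (c < p ^ n)%N & abv (ratr q - c%:R) <= p%:R ^- n.
Proof.
move=> q1; have pn0 : (0 < p ^ n)%N by rewrite expn_gt0 prime_gt0.
have Npb : ~~ (p %| `|denq q|)%N.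
  apply/negP => pb; move: q1; rewrite /padic_abv.
  have [q0|q0] := eqVneq q 0.
    by move: pb; rewrite q0 (_ : denq 0 = 1) ?absz1 ?dvdn1 // => /eqP p1; move: p_prime;
      rewrite p1.
  have lb : (0 < logn p `|denq q|)%N by rewrite logn_gt0 mem_primes p_prime absz_gt0 denq_neq0.
  have la : logn p `|numq q| = 0%N.
    apply: contraTeq (coprime_num_den q); rewrite -lt0n logn_gt0 mem_primes.
    move=> /and3P[_ _ pa]; apply: contraL pb => cab.
    by rewrite -prime_coprime // (coprime_dvdl pa).
  by rewrite la subr0 -exprnP leNgt exprn_egt1 ?padic_p_gt1 // (gtn_eqF lb).
have cop : coprimez (denq q) (p ^ n)%:Z.
  by rewrite coprimezE absz_nat; apply: coprimeXr; rewrite coprime_sym prime_coprime.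
have /coprimezP[[u v] /= uv] := cop.
pose c := (numq q * u %% (p ^ n)%:Z)%Z.
have pnZ : (p ^ n)%:Z != 0 by rewrite eqz_nat -lt0n.
have c0 : 0 <= c by rewrite modz_ge0.
have cE : c = `|c|%N by rewrite gez0_abs.
exists `|c|%N; first by rewrite -ltz_nat -cE ltz_pmod // ltz_nat.
pose w := (numq q * u %/ (p ^ n)%:Z)%Z * denq q + numq q * v.
have wE : numq q - c * denq q = w * (p ^ n)%:Z.
  rewrite -[numq q in LHS]mulr1 -uv /w /c.
  have := divz_eq (numq q * u) (p ^ n)%:Z.
  move: (_ %/ _)%Z (_ %% _)%Z => d m dE.
  have -> : numq q * (u * denq q + v * (p ^ n)%:Z)
    = numq q * u * denq q + numq q * v * (p ^ n)%:Z by ring.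
  by rewrite dE; ring.
have den0 : (denq q)%:~R != 0 :> Qp.
  by rewrite padic_intr.
have -> : ratr q - `|c|%N%:R = w%:~R * p%:R ^+ n / (denq q)%:~R :> Qp.
  have -> : `|c|%N%:R = c%:~R :> Qp by rewrite pmulrn -cE.
  rewrite /ratr -natrX pmulrn -intrM -wE intrB intrM; field.
  by rewrite den0.
have lb : logn p `|denq q| = 0%N.
  by apply/eqP; rewrite -leqn0 leqNgt logn_gt0 mem_primes (negPf Npb) !andbF.
rewrite !(abvM abvP) (abvV abvP) (padic_abvz (denq_neq0 q)) lb expr0 !invr1 mulr1
  (abvX abvP) padic_abvp.
by rewrite exprVn ler_piMl ?padic_abvz_le1 // invr_ge0 exprn_ge0.
Qed.

(** Once multiplied by a power of p, the elements of the ball are integral, and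
   the integers modulo p^n approximate them. *)
Lemma padic_totally_bounded (M e : R) : 0 < e ->
  exists s : seq Qp, forall x, abv x <= M -> exists2 y, y \in s & abv (x - y) < e.
Proof.
move=> e0; have p1 := padic_p_gt1; have p0 : 0 < p%:R :> R by apply: lt_trans p1.
have pow_gt (x : R) : 0 <= x -> exists k, x < p%:R ^+ k.
  move=> x0; exists (Num.bound x); apply: lt_trans (archi_boundP x0) _.
  by rewrite -natrX ltr_nat ltn_expl // prime_gt1.
have [k kM] : exists k, `|M| + e < p%:R ^+ k by apply: pow_gt; rewrite addr_ge0 // ltW.
have pk0 : 0 < p%:R ^+ k :> R by rewrite exprn_gt0.
have [n ne] : exists n, p%:R ^+ k * 2 / e < p%:R ^+ n.
  by apply: pow_gt; rewrite divr_ge0 ?mulr_ge0 // ltW.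
have pn0 : 0 < p%:R ^+ n :> R by rewrite exprn_gt0.
have pK0 : p%:R != 0 :> Qp by have := padic_natr p.-1; rewrite prednK // prime_gt0.
exists [seq c%:R / p%:R ^+ k | c <- iota 0 (p ^ n)] => x xM.
have e20 : 0 < e / 2 / p%:R ^+ k by rewrite !divr_gt0.
have [q xq] := padic_dense hQp (p%:R ^+ k * x) e20.
have abvpk : abv (p%:R ^+ k) = (p%:R ^+ k)^-1 by rewrite (abvX abvP) padic_abvp exprVn.
have q1 : padic_abv R p q <= 1.
  rewrite -(padic_abv_ratr hQp).
  have := abv_triangle abvP (p%:R ^+ k * x) (ratr q - p%:R ^+ k * x).
  rewrite subrKC (abv_distC abvP (ratr q)) (abvM abvP) abvpk => h.
  have h2 : abv (ratr q) <= (M + e / 2) / p%:R ^+ k.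
    apply: le_trans h _; rewrite mulrDl; apply: lerD; last exact: ltW.
    by rewrite mulrC ler_wpM2r // invr_ge0 ltW.
  apply: le_trans h2 _; rewrite ler_pdivrMr // mul1r.
  have := ler_norm M; lra.
have [c cpn qc] := padic_integral_approx n q1.
exists (c%:R / p%:R ^+ k); first by apply/mapP; exists c; rewrite ?mem_iota.
have -> : x - c%:R / p%:R ^+ k = (p%:R ^+ k)^-1 * (p%:R ^+ k * x - c%:R).
  by field; rewrite expf_neq0.
rewrite (abvM abvP) (abvV abvP) abvpk invrK.
have := abv_sub_le abvP (p%:R ^+ k * x) (ratr q) c%:R.
have : p%:R ^- n < e / 2 / p%:R ^+ k :> R.
  rewrite ltr_pdivlMr // mulrC ltr_pdivrMr //.
  by move: ne; rewrite ltr_pdivrMr //; lra.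
move=> h1 h2; rewrite mulrC -ltr_pdivlMr //.
have -> : e / p%:R ^+ k = e / 2 / p%:R ^+ k + e / 2 / p%:R ^+ k by rewrite -mulrDl -splitr.
by apply: le_lt_trans h2 _; apply: ltrD => //; exact: le_lt_trans h1.
Qed.

(** For each precision, total boundedness provides a ball in the ultrafilter;
   completeness then provides the common limit of the centres. *)
Lemma ultra_compact_padic : ultra_compact abv.
Proof.
move=> T U UU f M UM.
have /choice[y yU] : forall n, exists y, U [set x | abv (f x - y) < n.+1%:R^-1].
  move=> n; have n0 : 0 < n.+1%:R^-1 :> R by rewrite invr_gt0.
  have [s sM] := padic_totally_bounded M n0.
  by have [|y _ yU] := @ultra_finite_cover _ _ UU _ s _ (fun y
    => [set x | abv (f x - y) < n.+1%:R^-1]) _ UM; [move=> x /sM|exists y].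
have small (e : R) : 0 < e -> exists N, forall n, (N <= n)%N -> n.+1%:R^-1 < e.
  move=> e0; exists (Num.bound e^-1) => n Nn.
  rewrite invf_plt ?posrE //; apply: lt_le_trans (archi_boundP _) _.
    by rewrite invr_ge0 ltW.
  by rewrite ler_nat ltnW.
have dist m n : abv (y m - y n) < m.+1%:R^-1 + n.+1%:R^-1.
  have [x [/= xm xn]] := filter_ex (filterI (yU m) (yU n)).
  apply: le_lt_trans (abv_sub_le abvP (y m) (f x) (y n)) _.
  by rewrite (abv_distC abvP (y m)) ltrD.
have [l yl] : exists l, forall e : R, 0 < e ->
    exists N, forall n, (N <= n)%N -> abv (y n - l) < e.
  apply: (padic_complete hQp) => e e0; have e20 : 0 < e / 2 by rewrite divr_gt0.
  have [N NP] := small _ e20; exists N => m n /NP mN /NP nN.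
  by apply: lt_trans (dist m n) _; rewrite [e]splitr ltrD.
exists l => e e0; have e20 : 0 < e / 2 by rewrite divr_gt0.
have [N NP] := small _ e20; have [N' NP'] := yl _ e20.
apply: filterS (yU (maxn N N')) => x /= xN.
apply: le_lt_trans (abv_sub_le abvP (f x) (y (maxn N N')) l) _.
rewrite [e]splitr; apply: ltrD; first exact: lt_trans xN (NP _ (leq_maxl _ _)).
exact: NP' (leq_maxr _ _).
Qed.

Lemma locally_compact_padic : locally_compact_char0 abv.
Proof.
split=> [||e e0|]; [exact: abvP|exact: ultra_compact_padic| |exact: padic_natr].
have p1 := padic_p_gt1; have p0 : 0 < p%:R :> R by apply: lt_trans p1.
exists (p%:R ^+ Num.bound e^-1).
  by have := padic_natr p.-1; rewrite prednK ?prime_gt0 //; exact: expf_neq0.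
rewrite (abvX abvP) padic_abvp exprVn invf_plt ?posrE ?exprn_gt0 //.
apply: lt_trans (archi_boundP _) _; first by rewrite invr_ge0 ltW.
by rewrite -natrX ltr_nat ltn_expl // prime_gt1.
Qed.

End PadicNumbers.

(** * Local fields *)

Section FiniteExtension.
Variables (R : realType) (K0 K : fieldType) (nu : K0 -> R) (abv : K -> R).
Variables (iota : {rmorphism K0 -> K}) (n : nat) (e : 'I_n -> K) (a : 'I_n -> K -> K0).
Hypotheses (lc0 : locally_compact_char0 nu) (abvP : absolute_value abv).
Hypothesis abv_iota : forall x, abv (iota x) = nu x.
Hypothesis coordK : forall x, \sum_j iota (a j x) * e j = x.
Hypothesis basis_free : forall b : 'I_n -> K0,
  \sum_j iota (b j) * e j = 0 -> forall j, b j = 0.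
Let nuP := lc_abv lc0.

Lemma tends_to_iota (T : Type) (F : set_system T) {FF : Filter F} (f : T -> K0) l :
  tends_to nu F f l -> tends_to abv F (fun x => iota (f x)) (iota l).
Proof.
by move=> fl r r0; apply: filterS (fl _ r0) => x /=; rewrite -rmorphB abv_iota.
Qed.

Lemma tends_to_combination (T : Type) (F : set_system T) {FF : Filter F}
    (b : 'I_n -> T -> K0) (l : 'I_n -> K0) :
  (forall j, tends_to nu F (b j) (l j)) ->
  tends_to abv F (fun x => \sum_j iota (b j x) * e j) (\sum_j iota (l j) * e j).
Proof.
move=> bl; apply: (@tends_to_sum _ _ _ abvP _ _ _ _ _ (fun j x => iota (b j x) * e j)) => j.
apply: tends_toM => //; [exact: tends_to_iota|exact: tends_to_cst].
Qed.

(** Coordinates of bounded elements are bounded: otherwise, dividing by the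
   largest coordinate and passing to the limit gives a linear relation between
   the basis elements with a coefficient 1. *)
Lemma ultra_compact_extension : ultra_compact abv.
Proof.
move=> T U UU f M UM.
have [j _ jmax] : exists2 j, j \in enum 'I_n &
    U [set x | forall k, nu (a k (f x)) <= nu (a j (f x))].
  apply: (@ultra_finite_cover _ _ UU _ _ setT _ _ filterT) => x _.
  have [j0 _|n0] := pickP 'I_n; last first.
    have := coordK 1; rewrite big_pred0 // => /esym/eqP; by rewrite oner_eq0.
  case: (@arg_maxP _ _ _ j0 xpredT (fun j => nu (a j (f x))) isT) => j _ jP.
  by exists j; rewrite ?mem_enum // => k /=; exact: jP.
pose c x := a j (f x).
have [[C UC]|noC] := pselect (exists C, U [set x | nu (c x) <= C]).
  have /choice[l al] k : exists l, tends_to nu U (fun x => a k (f x)) l.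
    apply: (@lc_compact _ _ _ lc0 _ U UU _ C); apply: filterS2 jmax UC => x /= jx.
    exact: le_trans.
  exists (\sum_j iota (l j) * e j).
  by apply: tends_to_eq (tends_to_combination al) => x; exact: coordK.
have big C : U [set x | C < nu (c x)].
  have [UC|] := in_ultra_setVsetC [set x | nu (c x) <= C] UU; first by case: noC; exists C.
  by apply: filterS => x /= /negP; rewrite -ltNge.
have c0 : U [set x | c x != 0].
  by apply: filterS (big 0) => x /=; apply: contraTneq => ->; rewrite (abv0 nuP) ltxx.
have /choice[l bl] k : exists l, tends_to nu U (fun x => a k (f x) / c x) l.
  apply: (@lc_compact _ _ _ lc0 _ U UU _ 1); apply: filterS2 jmax c0 => x /= jx cx.
  by rewrite (abvM nuP) (abvV nuP) ler_pdivrMr ?(abv_gt0 nuP) // mul1r.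
have l1 : l j = 1.
  apply: (tends_to_unique nuP (bl j)).
  apply: (tends_to_near (f := fun=> 1)); last exact: tends_to_cst.
  by apply: filterS c0 => x cx /=; rewrite divff.
suff l0 : \sum_k iota (l k) * e k = 0.
  by have := basis_free l0 j; rewrite l1 => /eqP; rewrite oner_eq0.
apply: (tends_to_unique abvP (tends_to_combination bl)) => r r0.
apply: filterS2 (filterI UM c0) (big (`|M| / r)) => x [/= xM cx] xr.
have -> : \sum_k iota (a k (f x) / c x) * e k = f x / iota (c x).
  rewrite -[in RHS](coordK (f x)) mulr_suml; apply: eq_bigr => k _.
  by rewrite fmorph_div mulrAC.
rewrite subr0 (abvM abvP) (abvV abvP) abv_iota ltr_pdivrMr ?(abv_gt0 nuP) //.
apply: le_lt_trans xM _; apply: le_lt_trans (ler_norm _) _.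
by rewrite mulrC -ltr_pdivrMr.
Qed.

Lemma locally_compact_extension : locally_compact_char0 abv.
Proof.
split=> [||r r0|m]; [exact: abvP|exact: ultra_compact_extension| |].
- have [x x0 xr] := lc_small lc0 r0; exists (iota x); first by rewrite fmorph_eq0.
  by rewrite abv_iota.
- by rewrite -(rmorph_nat iota) fmorph_eq0 (lc_natr lc0).
Qed.

End FiniteExtension.

(** R, C and the finite extensions of Q_p are treated alike, as finite
   extensions of R or Q_p with a basis. *)
Lemma local_field_locally_compact (R : realType) (K : preTopologicalFieldType) :
  local_field R K ->
  exists2 abv : K -> R, locally_compact_char0 abv & abv_induces_topology abv.
Proof.
move=> [abv [abvP topo cases]]; exists abv => //.
case: cases => [[f [g fK gK] fabv]|[f [g fK gK] fabv]|].
- apply: (@locally_compact_extension _ R K _ _ f 1 (fun=> 1) (fun=> g)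
  (locally_compact_real R)) => //.
    by move=> x; rewrite big_ord1 mulr1 gK.
  move=> b; rewrite big_ord1 mulr1 => /eqP; rewrite fmorph_eq0 => /eqP b0 j.
  by rewrite ord1.
- pose e (j : 'I_2) : K := if j == ord0 then 1 else f 'i%C.
  pose a (j : 'I_2) x : R := if j == ord0 then complex.Re (g x) else complex.Im (g x).
  have sumE (b : 'I_2 -> R) : \sum_j (f \o real_complex R) (b j) * e j
      = f (b ord0 +i* b (fintype.lift ord0 ord0))%C.
    rewrite !big_ord_recl big_ord0 /e /= addr0 mulr1 -rmorphM -rmorphD.
    by congr (f _); apply/eqP; rewrite eq_complex /=; apply/andP; split; apply/eqP; ring.
  apply: (@locally_compact_extension _ R K _ _ (f \o real_complex R) 2 e a
    (locally_compact_real R)) => //.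
  + move=> x; apply: (@complexI R); rewrite /= fabv normc_def /=.
    by rewrite expr0n /= addr0 sqrtr_sqr.
  + by move=> x; rewrite sumE /a /=; case: (g x) (gK x).
  + move=> b; rewrite sumE => /eqP; rewrite fmorph_eq0 => /eqP[b0 b1] j.
    by case: (unliftP ord0 j) => [k ->|->]; rewrite ?(ord1 k).
- move=> [p [p_prime [Qp [abvp [hQp [L [f [[g fK gK] fabv]]]]]]]].
  pose B := vbasis {: L}; pose e j : K := f B`_j.
  pose a j x : Qp := coord B j (g x).
  have sumE (b : 'I_(\dim {: L}) -> Qp) :
      \sum_j (f \o in_alg L) (b j) * e j = f (\sum_j b j *: B`_j).
    rewrite rmorph_sum; apply: eq_bigr => j _.
    by rewrite /e /= -rmorphM mulr_algl.
  apply: (@locally_compact_extension _ Qp K _ _ (f \o in_alg L) _ e a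
    (locally_compact_padic p_prime hQp)) => //.
  + by move=> x; rewrite sumE -coord_vbasis ?memvf.
  + move=> b; rewrite sumE => /eqP; rewrite fmorph_eq0 => /eqP b0.
    by have /freeP := basis_free (vbasisP {: L}); apply.
Qed.

(** * Newton's method with parameters *)

Section Newton.
Variables (R : realType) (K : fieldType) (abv : K -> R).
Hypothesis lcK : locally_compact_char0 abv.
Let abvP := lc_abv lcK.

Lemma exp_half_lt (e : R) : 0 < e -> exists N, forall n, (N <= n)%N -> 2^-1 ^+ n < e.
Proof.
move=> e0; exists (Num.bound e^-1) => n Nn.
rewrite exprVn invf_plt ?posrE ?exprn_gt0 //; apply: lt_le_trans (archi_boundP _) _.
  by rewrite invr_ge0 ltW.
by rewrite -natrX ler_nat (leq_trans Nn) // ltnW // ltn_expl.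
Qed.

(** Newton's iteration with a fixed slope d: the deviation of the actual slopes
   from d is so small that each step at least halves the value of g. *)
Lemma contraction_root (g : K -> K) (k : K -> K -> K) (d t0 : K) (r : R) :
  (forall t s, g t - g s = (t - s) * k t s) -> 0 < r -> d != 0 ->
  (forall t s, abv (t - t0) <= r -> abv (s - t0) <= r -> abv (k t s - d) <= abv d / 2) ->
  abv (g t0) <= abv d * r / 2 ->
  exists2 t, abv (t - t0) <= r & g t = 0.
Proof.
move=> gk r0 d0 kd gt0; have ad0 := abv_gt0 abvP d0.
pose t n := iter n (fun s => s - g s / d) t0.
have inv n : abv (t n - t0) <= r * (1 - 2^-1 ^+ n) /\ abv (g (t n)) <= abv d * r / 2 * 2^-1 ^+ n.
  elim: n => [|n [tn gn]].
    by rewrite /t /= expr0 !subrr mulr0 mulr1 (abv0 abvP).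
  have h0 : 0 < 2^-1 ^+ n :> R by rewrite exprn_gt0 ?invr_gt0.
  have rh0 : 0 < r * 2^-1 ^+ n by rewrite mulr_gt0.
  have step : t n.+1 - t n = - (g (t n) / d) by rewrite /t /= addrC addKr.
  have astep : abv (t n.+1 - t n) <= r * 2^-1 ^+ n / 2.
    rewrite step (abvN abvP) (abvM abvP) (abvV abvP) ler_pdivrMr //.
    by apply: le_trans gn _; rewrite le_eqVlt; apply/orP; left; apply/eqP; ring.
  have tn' : abv (t n.+1 - t0) <= r * (1 - 2^-1 ^+ n.+1).
    apply: le_trans (abv_sub_le abvP _ (t n) _) _; rewrite exprSr.
    by move: (_ ^+ n) astep tn => h; lra.
  have inr m : r * (1 - 2^-1 ^+ m) <= r by rewrite ler_piMr ?(ltW r0) // gerBl exprn_ge0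
    ?invr_ge0.
  split=> //; have -> : g (t n.+1) = (t n.+1 - t n) * (k (t n.+1) (t n) - d).
    rewrite mulrBr -gk step mulNr opprK divfK //; by rewrite subrK.
  rewrite (abvM abvP) exprSr.
  have kb := kd _ _ (le_trans tn' (inr _)) (le_trans tn (inr _)).
  apply: le_trans (ler_pM (abv_ge0 abvP _) (abv_ge0 abvP _) astep kb) _.
  by rewrite le_eqVlt; apply/orP; left; apply/eqP; ring.
have tr n : abv (t n - t0) <= r.
  by have [h _] := inv n; rewrite (le_trans h) // ler_piMr ?(ltW r0) // gerBl exprn_ge0 ?invr_ge0.
have [U [UU ooU]] := ultraFilterLemma eventually_filter.
have [l tl] : exists l, tends_to abv U t l.
  apply: (@lc_compact _ _ _ lcK _ U UU _ (abv t0 + r)); apply: filterE => n /=.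
  have := abv_triangle abvP t0 (t n - t0); rewrite subrKC => h.
  by apply: le_trans h _; rewrite lerD2l.
have lr : abv (l - t0) <= r.
  by apply: (tends_to_bound abvP tl); apply: filterE => n; exact: tr.
exists l => //; apply: (@tends_to_unique _ _ _ abvP _ U _ (g \o t)).
  move=> e e0; have e20 : 0 < e / (abv d * 2) by rewrite divr_gt0 ?mulr_gt0.
  apply: filterS (tl _ e20) => n /=; rewrite gk (abvM abvP) => tn.
  have kb : abv (k (t n) l) <= abv d * 2.
    have := abv_triangle abvP d (k (t n) l - d); rewrite subrKC.
    by have := kd _ _ (tr n) lr; lra.
  apply: le_lt_trans (_ : abv (t n - l) * (abv d * 2) < e).
    by rewrite ler_wpM2l // (abv_ge0 abvP).
  by rewrite -ltr_pdivlMr // mulr_gt0.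
move=> e e0; have [|N NP] := @exp_half_lt (e / (abv d * r)); first by rewrite divr_gt0 ?mulr_gt0.
apply: ooU; exists N => // n /NP; rewrite ltr_pdivlMr ?mulr_gt0 // /= subr0 => h.
have [_ gn] := inv n; have h0 : 0 < 2^-1 ^+ n :> R by rewrite exprn_gt0 ?invr_gt0.
apply: le_lt_trans gn _; apply: le_lt_trans h; rewrite mulrC ler_wpM2l ?ltW //.
by rewrite gtr_pMr ?mulr_gt0 // invf_lt1 // ltr1n.
Qed.

(** The divided difference is the slope in Newton's iteration; near the diagonal
   it is close to the derivative. *)
Lemma poly_divided_difference (p : {poly K}) (t0 : K) :
  exists2 k : K -> K -> K, (forall t s, p.[t] - p.[s] = (t - s) * k t s) &
    tends_to abv (filter_prod (near_pt abv t0) (near_pt abv t0))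
      (fun z => k z.1 z.2) p^`().[t0].
Proof.
have id0 := near_pt_id abv t0.
elim/poly_ind: p => [|p c [k pk kl]].
  by exists (fun _ _ => 0) => [t s|]; [rewrite !horner0 subrr mulr0|rewrite deriv0 horner0;
    exact: tends_to_cst].
exists (fun t s => p.[t] + s * k t s) => [t s|].
  rewrite !hornerE; have pE : p.[t] = p.[s] + (t - s) * k t s by rewrite -pk subrKC.
  by rewrite pE; ring.
rewrite derivD derivM derivX derivC addr0 mulr1 !hornerE [X in tends_to _ _ _ X]addrC.
apply: tends_toD => //; last first.
  by rewrite mulrC; apply: tends_toM => //; exact: (tends_to_snd (f := id)).
apply: (tends_to_fst (f := horner p)).
elim/poly_ind: p {pk kl k} => [|p a pl].
  rewrite horner0; apply: (tends_to_eq (f := fun=> 0)) => [t|]; last exact: tends_to_cst.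
  by rewrite horner0.
rewrite !hornerE; apply: (tends_to_eq (f := fun t => p.[t] * t + a)) => [t|].
  by rewrite !hornerE.
apply: tends_toD => //; [exact: tends_toM|exact: tends_to_cst].
Qed.

(** Persistence of simple roots: near the initial root the slope stays close to the
   derivative, so Newton's iteration contracts one fixed ball for all parameters
   close to the initial one.  The property E stands for the open conditions that
   hold at the initial root and have to be kept. *)
Lemma simple_root_persists (T : Type) (F : set_system T) {FF : Filter F} n
    (p : 'I_n -> {poly K}) (a : T -> 'I_n -> K) (a0 : 'I_n -> K) (t0 : K)
    (E : T -> K -> Prop) :
  (forall i, tends_to abv F (a^~ i) (a0 i)) ->
  \sum_i a0 i * (p i).[t0] = 0 -> \sum_i a0 i * (p i)^`().[t0] != 0 ->
  filter_prod F (near_pt abv t0) [set z | E z.1 z.2] ->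
  F [set x | exists2 t, \sum_i a x i * (p i).[t] = 0 & E x t].
Proof.
move=> al root0 simple [[A B]/= [FA [r r0 rB]] ABE].
set d := \sum_i _ in simple.
have /choice[k kP] i : exists k : K -> K -> K,
    (forall t s, (p i).[t] - (p i).[s] = (t - s) * k t s) /\
    tends_to abv (filter_prod (near_pt abv t0) (near_pt abv t0))
      (fun z => k z.1 z.2) (p i)^`().[t0].
  by have [k] := poly_divided_difference (p i) t0; exists k.
have d2 : 0 < abv d / 2 by rewrite divr_gt0 ?(abv_gt0 abvP).
have kl : tends_to abv (filter_prod F (filter_prod (near_pt abv t0) (near_pt abv t0)))
    (fun z => \sum_i a z.1 i * k i z.2.1 z.2.2) d.
  apply: (@tends_to_sum _ _ _ abvP _ _ _ _ _ (fun i z => a z.1 i * k i z.2.1 z.2.2)) => i.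
  apply: tends_toM => //; first exact: (tends_to_fst (f := a^~ i)).
  exact: (tends_to_snd (f := fun z => k i z.1 z.2) (kP i).2).
have [[A1 B1]/= [FA1 [[B2 B3]/= [[r2 r20 rB2] [r3 r30 rB3]] B23]] AB1] := kl _ d2.
pose r' := Num.min r (Num.min r2 r3) / 2.
have m0 : 0 < Num.min r (Num.min r2 r3) by rewrite !lt_min r0 r20.
have r'0 : 0 < r' by rewrite divr_gt0.
have r'm : r' < Num.min r (Num.min r2 r3) by rewrite ltr_pdivrMr // ltr_pMr // ltr1n.
have gl : tends_to abv F (fun x => \sum_i a x i * (p i).[t0]) 0.
  rewrite -[X in tends_to _ _ _ X]root0;
    apply: (@tends_to_sum _ _ _ abvP _ _ _ _ _ (fun i x => a x i * (p i).[t0])) => i.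
  by apply: tends_toM => //; exact: tends_to_cst.
have dr : 0 < abv d * r' / 2 by rewrite divr_gt0 // mulr_gt0 // (abv_gt0 abvP).
apply: filterS2 (filterI FA FA1) (gl _ dr) => x [/= Ax A1x]; rewrite subr0 => gx.
have inB t : abv (t - t0) <= r' -> [/\ B t, B2 t & B3 t].
  move=> tr; have := le_lt_trans tr r'm; rewrite !lt_min => /and3P[h1 h2 h3].
  by split; [exact: rB|exact: rB2|exact: rB3].
have gk t s : \sum_i a x i * (p i).[t] - \sum_i a x i * (p i).[s] =
    (t - s) * \sum_i a x i * k i t s.
  rewrite -sumrB mulr_sumr; apply: eq_bigr => i _.
  by rewrite -mulrBr (kP i).1 mulrCA.
have kd t s : abv (t - t0) <= r' -> abv (s - t0) <= r' ->
    abv (\sum_i a x i * k i t s - d) <= abv d / 2.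
  move=> /inB[_ tB _] /inB[_ _ sB]; apply/ltW.
  by apply: (AB1 (x, (t, s))); split=> //; exact: (B23 (t, s)).
have [t tr gt] := contraction_root gk r'0 simple kd (ltW gx).
by exists t => //; apply: (ABE (x, t)); split=> //; have [] := inB t tr.
Qed.

End Newton.

(** * Symmetric trilinear forms and smooth cubic forms *)

Section TrilinearForms.
Variables (n : nat).

Definition tri (A : comNzRingType) (phi : 'I_n -> 'I_n -> 'I_n -> A)
    (x y z : 'rV[A]_n) : A :=
  \sum_i \sum_j \sum_k phi i j k * x 0 i * y 0 j * z 0 k.

Lemma tri_rmorph (A B : comNzRingType) (f : {rmorphism A -> B}) phi x y z :
  f (tri phi x y z) =
  tri (fun i j k => f (phi i j k)) (map_mx f x) (map_mx f y) (map_mx f z).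
Proof.
rewrite /tri rmorph_sum; apply: eq_bigr => i _; rewrite rmorph_sum.
apply: eq_bigr => j _; rewrite rmorph_sum; apply: eq_bigr => k _.
by rewrite !rmorphM !mxE.
Qed.

Section Symmetric.
Variables (A : comNzRingType) (phi : 'I_n -> 'I_n -> 'I_n -> A).
Local Notation T := (tri phi).

Lemma triDl x x' y z : T (x + x') y z = T x y z + T x' y z.
Proof.
rewrite /tri -big_split; apply: eq_bigr => i _; rewrite -big_split.
apply: eq_bigr => j _; rewrite -big_split; apply: eq_bigr => k _.
by rewrite mxE /=; ring.
Qed.

Lemma triZl a x y z : T (a *: x) y z = a * T x y z.
Proof.
rewrite /tri mulr_sumr; apply: eq_bigr => i _; rewrite mulr_sumr.
apply: eq_bigr => j _; rewrite mulr_sumr; apply: eq_bigr => k _.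
by rewrite mxE; ring.
Qed.

Hypotheses (phiC12 : forall i j k, phi i j k = phi j i k)
  (phiC23 : forall i j k, phi i j k = phi i k j).

Lemma triC12 x y z : T x y z = T y x z.
Proof.
rewrite /tri exchange_big; apply: eq_bigr => i _; apply: eq_bigr => j _.
by apply: eq_bigr => k _; rewrite phiC12; ring.
Qed.

Lemma triC23 x y z : T x y z = T x z y.
Proof.
rewrite /tri; apply: eq_bigr => i _; rewrite exchange_big; apply: eq_bigr => j _.
by apply: eq_bigr => k _; rewrite phiC23; ring.
Qed.

Lemma triC13 x y z : T x y z = T z y x.
Proof. by rewrite triC12 triC23 triC12. Qed.

Lemma tri_comb1 a b x y z w : T (a *: x + b *: y) z w = a * T x z w + b * T y z w.
Proof. by rewrite triDl !triZl. Qed.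

Lemma tri_comb2 a b x y z w : T z (a *: x + b *: y) w = a * T z x w + b * T z y w.
Proof. by rewrite triC12 tri_comb1 !(triC12 z). Qed.

Lemma tri_comb3 a b x y z w : T z w (a *: x + b *: y) = a * T z w x + b * T z w y.
Proof. by rewrite triC13 tri_comb1 !(triC13 z). Qed.

Lemma tri_quad a b x y w :
  T (a *: x + b *: y) (a *: x + b *: y) w =
  a ^+ 2 * T x x w + a * b * T x y w *+ 2 + b ^+ 2 * T y y w.
Proof. by rewrite tri_comb1 !tri_comb2 (triC12 y x); ring. Qed.

Lemma tri_cubic a b x y :
  T (a *: x + b *: y) (a *: x + b *: y) (a *: x + b *: y) =
  a ^+ 3 * T x x x + a ^+ 2 * b * T x x y *+ 3 + a * b ^+ 2 * T x y y *+ 3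
  + b ^+ 3 * T y y y.
Proof.
rewrite tri_quad !tri_comb3 (triC23 x y x) (triC13 y y x); ring.
Qed.

Lemma tri_basis x y z : T x y z = \sum_k z 0 k * T x y (delta_mx 0 k).
Proof.
transitivity (\sum_k T x y (z 0 k *: delta_mx 0 k)); last first.
  apply: eq_bigr => k _; have := tri_comb3 (z 0 k) 0 (delta_mx 0 k) 0 x y.
  by rewrite scale0r mul0r !addr0.
rewrite {1}(row_sum_delta z) (triC13 x y).
elim/big_ind2: _ => [|u1 u2 v1 v2 h1 h2|k _]; last by rewrite triC13.
  by rewrite -(scale0r 0) triZl mul0r.
by rewrite triDl -h1 -h2.
Qed.

End Symmetric.
End TrilinearForms.

Section Independence.
Variables (n : nat) (K : fieldType).
Implicit Types x y : 'rV[K]_n.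

Definition wedge x y (i j : 'I_n) : K := x 0 i * y 0 j - x 0 j * y 0 i.

(** Linear independence, as the nonvanishing of a minor: in this form it is
   visibly an open condition, and is preserved by field extensions. *)
Definition indep x y : Prop := exists i j, wedge x y i j != 0.

Lemma indep_scale x y : x != 0 -> ~ indep x y -> exists c, y = c *: x.
Proof.
move=> /rV0Pn[i xi] nxy; exists (y 0 i / x 0 i); apply/rowP => j; rewrite !mxE.
apply: (mulfI xi); rewrite mulrA mulrCA divff // mulr1.
apply/eqP; rewrite -subr_eq0 [y 0 i * _]mulrC; apply/negPn/negP => xy; apply: nxy.
by exists i, j.
Qed.

Lemma indep_comb0 x y a b : indep x y -> a *: x + b *: y = 0 -> a = 0 /\ b = 0.
Proof.
move=> [i [j xy]] /rowP abE; have := abE i; have := abE j; rewrite !mxE => ej ei.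
have wa : a * wedge x y i j = 0.
  have -> : a * wedge x y i j = (a * x 0 i + b * y 0 i) * y 0 j - (a * x 0 j + b * y 0 j) * y 0 i.
    by rewrite /wedge; ring.
  by rewrite ei ej !mul0r subrr.
have wb : b * wedge x y i j = 0.
  have -> : b * wedge x y i j = (a * x 0 j + b * y 0 j) * x 0 i - (a * x 0 i + b * y 0 i) * x 0 j.
    by rewrite /wedge; ring.
  by rewrite ei ej !mul0r subrr.
by split; apply/eqP; [move/eqP: wa|move/eqP: wb]; rewrite mulf_eq0 (negPf xy) orbF.
Qed.

Lemma indepC x y : indep x y -> indep y x.
Proof.
move=> [i [j xy]]; exists j, i; apply: contraNneq xy => <-; apply/eqP.
by rewrite /wedge; ring.
Qed.

Lemma indep_neq0 x y : indep x y -> x != 0.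
Proof.
by move=> [i [j]]; apply: contraNneq => ->; rewrite /wedge !mxE !mul0r subrr.
Qed.

Lemma wedge_comb x y a b c d i j :
  wedge (a *: x + b *: y) (c *: x + d *: y) i j = (a * d - b * c) * wedge x y i j.
Proof. by rewrite /wedge !mxE; ring. Qed.

End Independence.

(** A quadratic polynomial is reducible or has a root in an extension of
   degree 2. *)
Lemma binary_quadric_zero (K : fieldType) (a b c : K) :
  exists (L : fieldType) (f : {rmorphism K -> L}) (s t : L),
    (s != 0) || (t != 0) /\ s ^+ 2 * f a + s * t * f b + t ^+ 2 * f c = 0.
Proof.
have [a0|a0] := eqVneq a 0.
  exists K, (idfun : {rmorphism K -> K}), 1, 0; split; first by rewrite oner_eq0.
  by rewrite a0 /=; ring.
pose p := a *: 'X^2 + b *: 'X + c%:P.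
have hp (L : fieldType) (f : {rmorphism K -> L}) z :
    (map_poly f p).[z] = z ^+ 2 * f a + z * 1 * f b + 1 ^+ 2 * f c.
  rewrite /p !rmorphD /= !map_polyZ map_polyXn map_polyX map_polyC !hornerE /=; ring.
have szp : size p = 3%N.
  rewrite /p -addrA size_polyDl ?size_scale ?size_polyXn //.
  apply: leq_ltn_trans (size_polyD _ _) _; rewrite gtn_max.
  by rewrite (leq_ltn_trans (size_scale_leq _ _)) ?size_polyX // (leq_ltn_trans
    (size_polyC_leq1 _)).
have [[z pz]|noroot] := pselect (exists z, root p z).
  exists K, (idfun : {rmorphism K -> K}), z, 1; split; first by rewrite oner_eq0 orbT.
  by rewrite -hp map_poly_id //; apply/eqP.
have irr : irreducible_poly p.
  by apply: cubic_irreducible => [|z]; [rewrite szp|apply/negP => pz; apply: noroot; exists z].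
have [L _ [z pz _]] := irredp_FAdjoin irr.
exists L, (in_alg L : {rmorphism K -> L}), z, 1; split; first by rewrite oner_eq0 orbT.
by rewrite -hp; apply/eqP.
Qed.

Section SmoothCubicForms.
Variables (K : fieldType) (phi : 'I_4 -> 'I_4 -> 'I_4 -> K).
Local Notation T := (tri phi).
Hypotheses (natrK : forall n, n.+1%:R != 0 :> K)
  (phiC12 : forall i j k, phi i j k = phi j i k)
  (phiC23 : forall i j k, phi i j k = phi i k j).
Hypothesis smooth : forall (L : fieldType) (f : {rmorphism K -> L}) (x : 'rV[L]_4),
  x != 0 -> exists i, tri (fun i j k => f (phi i j k)) x x (delta_mx 0 i) != 0.

Lemma tangent_form_neq0 x : x != 0 -> exists y, T x x y != 0.
Proof.
by move=> /(smooth (idfun : {rmorphism K -> K}))[i xi]; exists (delta_mx 0 i).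
Qed.

(** A surface that has the same tangent plane along a whole line is singular
   somewhere on that line: the gradient is a binary quadratic form times a
   constant vector, so it vanishes at a point over a quadratic extension. *)
Lemma tangent_plane_varies (x y : 'rV[K]_4) (N : 'rV[K]_4 -> K) (a b c : K) :
  indep x y -> (forall v, T x x v = a * N v) -> (forall v, T x y v = b * N v) ->
  (forall v, T y y v = c * N v) -> False.
Proof.
move=> [i [j xy]] xxN xyN yyN.
have [L [f [s [t [st0 stE]]]]] := binary_quadric_zero a (b *+ 2) c.
pose z := s *: map_mx f x + t *: map_mx f y.
have z0 : z != 0.
  apply/eqP => z0; have xy' : indep (map_mx f x) (map_mx f y).
    by exists i, j; rewrite /wedge !mxE -!rmorphM -rmorphB fmorph_eq0.
  by have [s0 t0] := indep_comb0 xy' z0; move: st0; rewrite s0 t0 eqxx.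
have [k] := smooth f z0; rewrite /z tri_quad; last by move=> ? ? ?; rewrite phiC12.
have dE : delta_mx 0 k = map_mx f (delta_mx 0 k) :> 'rV[L]_4.
  by apply/rowP => v; rewrite !mxE rmorph_nat.
rewrite dE.
rewrite -!tri_rmorph xxN xyN yyN !rmorphM => /eqP; apply.
rewrite -[RHS](mul0r (f (N (delta_mx 0 k)))) -stE rmorphMn /=; ring.
Qed.

(** The kernel of c has dimension at least 3, and x, y span at most 2 dimensions. *)
Lemma plane_complement (c : 'cV[K]_4) (x y : 'rV[K]_4) :
  exists2 z : 'rV[K]_4, z *m c = 0 & forall a b, z <> a *: x + b *: y.
Proof.
have : ~~ (kermx c <= col_mx x y)%MS.
  apply/negP => /mxrankS; rewrite mxrank_ker leqNgt => /negP; apply.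
  apply: leq_ltn_trans (rank_leq_row _) _.
  by rewrite ltn_subRL (leq_ltn_trans (leq_add (rank_leq_col _) (leqnn _))).
move=> /row_subPn[i Ni]; exists (row i (kermx c)).
  by apply/sub_kermxP; exact: row_sub.
have xs : (x <= col_mx x y)%MS by rewrite -addsmxE addsmxSl.
have ys : (y <= col_mx x y)%MS by rewrite -addsmxE addsmxSr.
by move=> a b E; move: Ni; rewrite E addmx_sub // scalemx_sub.
Qed.

Lemma tri_mulmx x y z : T x y z = (z *m \col_k T x y (delta_mx 0 k)) 0 0.
Proof. by rewrite (tri_basis phiC12 phiC23) mxE; apply: eq_bigr => k _; rewrite mxE. Qed.

Lemma tangent_complement x y :
  exists2 z, T x x z = 0 & forall a b, z <> a *: x + b *: y.
Proof.
have [z z0 zxy] := plane_complement (\col_k T x x (delta_mx 0 k)) x y.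
by exists z => //; rewrite tri_mulmx z0 mxE.
Qed.

Lemma vanishing_on_kernel (f g : 'rV[K]_4 -> K) u :
  (forall a v w, f (v - a *: w) = f v - a * f w) ->
  (forall a v w, g (v - a *: w) = g v - a * g w) ->
  g u != 0 -> (forall v, g v = 0 -> f v = 0) -> forall v, f v = f u / g u * g v.
Proof.
move=> fL gL gu fg v; have := fg (v - (g v / g u) *: u).
rewrite gL divfK // subrr => /(_ erefl); rewrite fL => /eqP; rewrite subr_eq0 => /eqP ->.
by ring.
Qed.

(** A plane contained in the surface would be the tangent plane at each of its
   points, contradicting [tangent_plane_varies] on any line of it. *)
Lemma tangent_section_neq0 x : x != 0 -> T x x x = 0 ->
  exists2 w, T x x w = 0 & T w w w != 0.
Proof.
move=> x0 xS; apply: contrapT => noW.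
have flat w : T x x w = 0 -> T w w w = 0.
  by move=> xw; apply/eqP/negPn/negP => w0; apply: noW; exists w.
have flat2 w y : T x x w = 0 -> T x x y = 0 -> T w w y = 0.
  move=> xw xy; have comb a b : T x x (a *: w + b *: y) = 0.
    by rewrite (tri_comb3 phiC12 phiC23) xw xy !mulr0 addr0.
  have := flat _ (comb 1 1); have := flat _ (comb 1 (-1)).
  rewrite !(tri_cubic phiC12 phiC23) (flat w) // (flat y) // => h1 h2. 
  have : T w w y *+ 6 = 0.
    transitivity (0 - 0 : K); last by rewrite subrr.
    by rewrite -[X in _ = X - _]h2 -[X in _ = _ - X]h1; ring.
  by move/eqP; rewrite -mulr_natr mulf_eq0 (negPf (natrK 5)) orbF => /eqP.
have flat3 w y : T x x w = 0 -> T x x y = 0 -> T x w y = 0.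
  move=> xw xy; have xw1 : T x x (1 *: x + 1 *: w) = 0.
    by rewrite (tri_comb3 phiC12 phiC23) xw xS !mulr0 addr0.
  have := flat2 _ _ xw1 xy; rewrite (tri_quad phiC12) xy (flat2 w y) //.
  rewrite expr1n !mul1r add0r addr0 => /eqP.
  by rewrite -mulr_natr mulf_eq0 (negPf (natrK 1)) orbF => /eqP.
have [u xu] := tangent_form_neq0 x0.
have [w xw wx] := tangent_complement x x.
have ixw : indep x w.
  apply: contrapT => /(indep_scale x0)[c wE]; apply: (wx c 0).
  by rewrite scale0r addr0.
have lin y z a v v' : T y z (v - a *: v') = T y z v - a * T y z v'.
  have -> : v - a *: v' = 1 *: v + (- a) *: v' by rewrite scale1r scaleNr.
  by rewrite (tri_comb3 phiC12 phiC23); ring.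
have prop y z : (forall v, T x x v = 0 -> T y z v = 0) ->
    forall v, T y z v = T y z u / T x x u * T x x v.
  by apply: vanishing_on_kernel => // a v v'; exact: lin.
apply: (@tangent_plane_varies x w (T x x) 1 _ _ ixw).
- by move=> v; rewrite mul1r.
- by apply: prop => v; exact: flat3.
- by apply: prop => v; exact: flat2.
Qed.

End SmoothCubicForms.

(** * The surface near one of its points *)

Section CubicSurfaceTopology.
Variables (R : realType) (K : fieldType) (abv : K -> R).
Hypothesis lcK : locally_compact_char0 abv.
Variable phi : 'I_4 -> 'I_4 -> 'I_4 -> K.
Hypotheses (phiC12 : forall i j k, phi i j k = phi j i k)
  (phiC23 : forall i j k, phi i j k = phi i k j).
Hypothesis smooth : forall (L : fieldType) (f : {rmorphism K -> L}) (x : 'rV[L]_4),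
  x != 0 -> exists i, tri (fun i j k => f (phi i j k)) x x (delta_mx 0 i) != 0.
Local Notation T := (tri phi).
Let abvP := lc_abv lcK.
Let natrK := lc_natr lcK.

Definition vtends_to (I : Type) (F : set_system I) (f : I -> 'rV[K]_4) (l : 'rV[K]_4) :=
  forall i, tends_to abv F (fun x => f x 0 i) (l 0 i).

Section VectorLimits.
Variables (I : Type) (F : set_system I).
Context {FF : Filter F}.

Lemma vtends_to_cst l : vtends_to F (fun=> l) l.
Proof. by move=> i; exact: tends_to_cst. Qed.

Lemma vtends_toD f g l m :
  vtends_to F f l -> vtends_to F g m -> vtends_to F (fun x => f x + g x) (l + m).
Proof.
move=> fl gm i; rewrite mxE; apply: tends_to_eq (tends_toD abvP (fl i) (gm i)) => x.
by rewrite mxE.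
Qed.

Lemma vtends_toZ a f b l :
  tends_to abv F a b -> vtends_to F f l -> vtends_to F (fun x => a x *: f x) (b *: l).
Proof.
move=> ab fl i; rewrite mxE; apply: tends_to_eq (tends_toM abvP ab (fl i)) => x.
by rewrite mxE.
Qed.

Lemma tends_to_tri f g h l m n :
  vtends_to F f l -> vtends_to F g m -> vtends_to F h n ->
  tends_to abv F (fun x => T (f x) (g x) (h x)) (T l m n).
Proof.
move=> fl gm hn; rewrite /tri.
apply: (@tends_to_sum _ _ _ abvP _ _ _ _ _ 
  (fun i x => \sum_j \sum_k phi i j k * f x 0 i * g x 0 j * h x 0 k)) => i.
apply: (@tends_to_sum _ _ _ abvP _ _ _ _ _ 
  (fun j x => \sum_k phi i j k * f x 0 i * g x 0 j * h x 0 k)) => j.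
apply: (@tends_to_sum _ _ _ abvP _ _ _ _ _ 
  (fun k x => phi i j k * f x 0 i * g x 0 j * h x 0 k)) => k.
apply: tends_toM => //; apply: tends_toM => //; apply: tends_toM => //.
exact: tends_to_cst.
Qed.

Lemma tends_to_wedge f g l m i j :
  vtends_to F f l -> vtends_to F g m ->
  tends_to abv F (fun x => wedge (f x) (g x) i j) (wedge l m i j).
Proof. by move=> fl gm; apply: tends_toB => //; apply: tends_toM. Qed.

End VectorLimits.

Lemma near_vec_id (x : 'rV[K]_4) : vtends_to (near_vec abv x) id x.
Proof. by move=> i; exact: near_vec_coord. Qed.

Lemma near_vec_neq0 (x : 'rV[K]_4) : x != 0 -> near_vec abv x [set y | y != 0].
Proof.
move=> /rV0Pn[i xi]; apply: filterS (tends_to_neq0 abvP (near_vec_id x i) xi) => y /= yi.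
by apply: contraNneq yi => ->; rewrite mxE.
Qed.

Lemma near_pt0_neq0 (A : set K) : near_pt abv 0 A -> exists2 e, e != 0 & A e.
Proof.
move=> [r r0 rA]; have [e e0 er] := lc_small lcK r0.
by exists e => //; apply: rA; rewrite subr0.
Qed.

(** In the tangent direction W at P the surface is a graph over the tangent
   plane: it contains points P + e (W + z Z) with z small, for all small e. *)
Lemma surface_point_near (P W Z : 'rV[K]_4) (E : K -> K -> Prop) :
  T P P P = 0 -> T P P W = 0 -> T P P Z != 0 ->
  filter_prod (near_pt abv 0) (near_pt abv 0) [set y | E y.1 y.2] ->
  near_pt abv 0 [set e | exists2 z,
    let Q := P + e *: (W + z *: Z) in T Q Q Q = 0 & E e z].
Proof.
move=> PS PW PZ EE.
pose p (i : 'I_3) : {poly K} := nth 0 [::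
  (T P P Z *+ 3) *: 'X;
  (T P W W *+ 3)%:P + (T P W Z *+ 6) *: 'X + (T P Z Z *+ 3) *: 'X^2;
  (T W W W)%:P + (T W W Z *+ 3) *: 'X + (T W Z Z *+ 3) *: 'X^2 + T Z Z Z *: 'X^3] i.
have pE (a : 'I_3 -> K) t : \sum_i a i * (p i).[t] =
    a 0 * (t * T P P Z *+ 3) +
    a 1 * (T P W W *+ 3 + t * T P W Z *+ 6 + t ^+ 2 * T P Z Z *+ 3) +
    a 2%:R * (T W W W + t * T W W Z *+ 3 + t ^+ 2 * T W Z Z *+ 3 + t ^+ 3 * T Z Z Z).
  rewrite !big_ord_recl big_ord0 /p /= !(hornerD, hornerZ, hornerXn, hornerX, hornerC).
  have -> : fintype.lift ord0 ord0 = 1 :> 'I_3 by apply/val_inj.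
  have -> : fintype.lift ord0 (fintype.lift ord0 ord0) = 2%:R :> 'I_3 by apply/val_inj.
  rewrite (_ : ord0 = 0) //; ring.
have p'E : \sum_(i < 3) 0 ^+ i * (p i)^`().[0] = T P P Z *+ 3.
  rewrite !big_ord_recl big_ord0 /p /= expr0 mul1r !expr0n /= !mul0r !addr0.
  by rewrite derivZ derivX hornerZ hornerC mulr1.
have root0 : \sum_(i < 3) 0 ^+ i * (p i).[0] = 0.
  by rewrite (pE (fun i => 0 ^+ i)) /= !expr0n /=; ring.
have simple : \sum_(i < 3) 0 ^+ i * (p i)^`().[0] != 0.
  by rewrite p'E -mulr_natr mulf_neq0 // (natrK 2).
have al (i : 'I_3) : tends_to abv (near_pt abv 0) (fun e => e ^+ i) (0 ^+ i).
  by apply: tends_toX => //; exact: near_pt_id.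
apply: filterS (simple_root_persists lcK al root0 simple EE) => e [z ez Eez].
exists z => //.
move: ez; rewrite (pE (fun i => e ^+ i)) (_ : e ^+ (2%:R : 'I_3) = e ^+ 2) //=.
rewrite expr0 expr1 => /(congr1 ( *%R e)); rewrite mulr0 => <-.
have -> : P + e *: (W + z *: Z) = 1 *: P + e *: (1 *: W + z *: Z) by rewrite !scale1r.
rewrite (tri_cubic phiC12 phiC23) (tri_cubic phiC12 phiC23) !(tri_comb3 phiC12 phiC23).
rewrite !(tri_comb2 phiC12) PS PW (triC23 phiC23 P Z W); ring.
Qed.

(** Otherwise the second fundamental form would vanish identically near P, and its
   derivative at P would force F to vanish on the tangent plane.  In the proof W' is
   a tangent vector at x = P + e X that tends to a multiple of W, and the second
   fundamental form takes at W' the value e H, where H tends to a nonzero multiple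
   of F(W). *)
Lemma exists_nonflat_point (P : 'rV[K]_4) : P != 0 -> T P P P = 0 ->
  exists x W, [/\ x != 0, T x x x = 0, T x x W = 0 & T x W W != 0].
Proof.
move=> P0 PS; have [W PW WW] := tangent_section_neq0 natrK phiC12 phiC23 smooth P0 PS.
have [Z PZ] := tangent_form_neq0 smooth P0.
have [PWW|] := eqVneq (T P W W) 0; last by exists P, W.
pose X (y : K * K) := W + y.2 *: Z; pose x y := P + y.1 *: X y.
pose mu y := y.2 * T P Z W *+ 2 + y.1 * T (X y) (X y) W.
pose nu y := T (x y) (x y) Z.
pose H y := nu y ^+ 2 * T (X y) W W - nu y * mu y * T (x y) W Z *+ 2
  + y.1 * mu y ^+ 2 * T (x y) Z Z.
pose F2 := filter_prod (near_pt abv 0) (near_pt abv 0).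
have l1 : tends_to abv F2 fst 0 by exact: (tends_to_fst (f := id) (near_pt_id _ _)).
have l2 : tends_to abv F2 snd 0 by exact: (tends_to_snd (f := id) (near_pt_id _ _)).
have cW l : vtends_to F2 (fun=> l) l by exact: vtends_to_cst.
have lX : vtends_to F2 X W.
  by have := vtends_toD (cW W) (vtends_toZ l2 (cW Z)); rewrite scale0r addr0; apply.
have lx : vtends_to F2 x P.
  by have := vtends_toD (cW P) (vtends_toZ l1 lX); rewrite scale0r addr0; apply.
have lnu : tends_to abv F2 nu (T P P Z) by exact: tends_to_tri.
have lmu : tends_to abv F2 mu 0.
  have -> : 0 = 0 * T P Z W *+ 2 + 0 * T W W W by rewrite !mul0r mul0rn addr0.
  apply: tends_toD => //; first apply: tends_toMn => //; apply: tends_toM => //.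
    exact: tends_to_cst.
  exact: tends_to_tri.
have lH : tends_to abv F2 H (T P P Z ^+ 2 * T W W W).
  have -> : T P P Z ^+ 2 * T W W W = T P P Z ^+ 2 * T W W W - T P P Z * 0 * T P W Z *+ 2
      + 0 * 0 ^+ 2 * T P Z Z by rewrite expr0n /=; ring.
  apply: tends_toD => //; first apply: tends_toB => //.
  - by apply: tends_toM => //; [exact: tends_toX|exact: tends_to_tri].
  - apply: tends_toMn => //; apply: tends_toM => //; first exact: tends_toM.
    exact: tends_to_tri.
  - apply: tends_toM => //; last exact: tends_to_tri.
    by apply: tends_toM => //; exact: tends_toX.
have EE : F2 [set y | H (y.1, y.2) != 0].
  have H0 : T P P Z ^+ 2 * T W W W != 0 by rewrite mulf_neq0 // expf_neq0.
  by apply: filterS (tends_to_neq0 abvP lH H0) => -[].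
have [e e0 [z xS Hz]] := near_pt0_neq0
  (surface_point_near (E := fun e z => H (e, z) != 0) PS PW PZ EE).
pose y := (e, z); pose W' := nu y *: W + (- (e * mu y)) *: Z.
have xE : P + e *: (W + z *: Z) = x y by [].
rewrite xE in xS.
have xW : T (x y) (x y) W = e * mu y.
  have PXW : T P (W + z *: Z) W = z * T P Z W.
    by rewrite -[W in W + _]scale1r (tri_comb2 phiC12) PWW; ring.
  by rewrite -xE -[P]scale1r (tri_quad phiC12) PW PXW /mu /X /=; ring.
have xWW : T (x y) W W = e * T (X y) W W.
  by rewrite -xE -[P]scale1r tri_comb1 PWW mulr0 add0r.
have W'x : T (x y) (x y) W' = 0.
  by rewrite (tri_comb3 phiC12 phiC23) xW -/(nu y); ring.
have W'W' : T (x y) W' W' = e * H y.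
  rewrite /W' !(tri_comb2 phiC12) !(tri_comb3 phiC12 phiC23) xWW (triC23 phiC23 (x y) Z W) /H /=.
  ring.
have xW'0 : T (x y) W' W' != 0 by rewrite W'W' mulf_neq0.
exists (x y), W'; split=> //; apply: contraNneq xW'0 => ->.
by rewrite -(scale0r 0) triZl mul0r.
Qed.

(** If the plane T(X, X, .) = 0 is not the tangent plane at u, one leaves it by
   moving in a tangent direction at u that is transverse to it.  If it is the
   tangent plane, one leaves it by moving in a direction W with F(W) <> 0, because
   u + e W is then off the surface for small e <> 0. *)
Lemma near_point_off_plane (u X : 'rV[K]_4) (A : set 'rV[K]_4) :
  u != 0 -> T u u u = 0 -> X != 0 -> near_vec abv u A ->
  exists x, [/\ A x, T x x x = 0 & T X X x != 0].
Proof.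
move=> u0 uS X0 uA.
have [Xu|Xu] := eqVneq (T X X u) 0; last first.
  by exists u; split=> //; exact: near_vec_self uA.
have [Z uZ] := tangent_form_neq0 smooth u0.
pose F2 := filter_prod (near_pt abv 0) (near_pt abv 0).
have l1 : tends_to abv F2 fst 0 by exact: (tends_to_fst (f := id) (near_pt_id _ _)).
have l2 : tends_to abv F2 snd 0 by exact: (tends_to_snd (f := id) (near_pt_id _ _)).
have cW l : vtends_to F2 (fun=> l) l by exact: vtends_to_cst.
have lX W : vtends_to F2 (fun y => W + y.2 *: Z) W.
  by have := vtends_toD (cW W) (vtends_toZ l2 (cW Z)); rewrite scale0r addr0; apply.
have FA W : F2 [set y | A (u + y.1 *: (W + y.2 *: Z))].
  have lu : vtends_to F2 (fun y => u + y.1 *: (W + y.2 *: Z)) u.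
    by have := vtends_toD (cW u) (vtends_toZ l1 (lX W)); rewrite scale0r addr0; apply.
  exact: (tends_to_near_vec lu uA).
have NX w e z : T X X (u + e *: (w + z *: Z)) = e * (T X X w + z * T X X Z).
  have -> : u + e *: (w + z *: Z) = 1 *: u + e *: (1 *: w + z *: Z) by rewrite !scale1r.
  rewrite !(tri_comb3 phiC12 phiC23) Xu; ring.
have [exW|flat] := pselect (exists2 W, T u u W = 0 & T X X W != 0).
  have {exW} [W uW XW] := exW.
  have EE : F2 [set y | A (u + y.1 *: (W + y.2 *: Z)) /\ T X X (W + y.2 *: Z) != 0].
    apply: filterI (FA W) _.
    exact: (tends_to_neq0 abvP (tends_to_tri (cW X) (cW X) (lX W)) XW).
  have [e e0 [z xS [xA xX]]] := near_pt0_neq0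
    (surface_point_near (E := fun e z
      => A (u + e *: (W + z *: Z)) /\ T X X (W + z *: Z) != 0) uS uW uZ EE).
  exists (u + e *: (W + z *: Z)); split=> //.
  move: xX; rewrite NX -[W in T X X (W + _)]scale1r (tri_comb3 phiC12 phiC23) mul1r.
  exact: mulf_neq0.
have flat' W : T u u W = 0 -> T X X W = 0.
  by move=> uW; apply/eqP/negPn/negP => XW; apply: flat; exists W.
have XZ : T X X Z != 0.
  have [v Xv] := tangent_form_neq0 smooth X0; apply: contraNneq Xv => XZ.
  have : T u u (1 *: v + (- (T u u v / T u u Z)) *: Z) = 0.
    by rewrite (tri_comb3 phiC12 phiC23) mulNr divfK // mul1r subrr.
  by move/flat'; rewrite (tri_comb3 phiC12 phiC23) XZ mulr0 addr0 mul1r => ->.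
have [W uW WW] := tangent_section_neq0 natrK phiC12 phiC23 smooth u0 uS.
have offT : near_pt abv 0 [set e | e != 0 -> T u W W *+ 3 + e * T W W W != 0].
  have [uWW|uWW] := eqVneq (T u W W) 0.
    by apply: filterE => e /= e0; rewrite uWW mul0rn add0r mulf_neq0.
  have h : tends_to abv (near_pt abv 0) (fun e
    => T u W W *+ 3 + e * T W W W) (T u W W *+ 3 + 0 * T W W W).
    apply: tends_toD => //; first exact: tends_to_cst.
    by apply: tends_toM => //; [exact: near_pt_id|exact: tends_to_cst].
  have n0 : T u W W *+ 3 + 0 * T W W W != 0.
    by rewrite mul0r addr0 -mulr_natr mulf_neq0 // (natrK 2).
  by apply: filterS (tends_to_neq0 abvP h n0) => e /= he _.
have [e e0 [[z xS xA] /(_ e0) eW]] := near_pt0_neq0 (filterI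
    (surface_point_near (E := fun e z => A (u + e *: (W + z *: Z))) uS uW uZ (FA W)) offT).
exists (u + e *: (W + z *: Z)); split=> //; rewrite NX flat' // add0r mulf_neq0 // mulf_neq0 //.
apply: contraNneq eW => z0; move: xS; rewrite /= z0 scale0r addr0 => xS.
have := tri_cubic phiC12 phiC23 1 e u W; rewrite scale1r xS uS uW => h.
have : e ^+ 2 * (T u W W *+ 3 + e * T W W W) = 0 by rewrite [RHS]h; ring.
by move/eqP; rewrite mulf_eq0 expf_eq0 (negPf e0).
Qed.

(** In the application cls x is the class of the point x and h is the class of
   every line cycle. *)
Section ClassFunction.
Variables (A : zmodType) (cls : 'rV[K]_4 -> A) (h : A).
Hypothesis clsZ : forall c x, c != 0 -> x != 0 -> T x x x = 0 -> cls (c *: x) = cls x.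
Hypothesis cls_secant : forall x y a b, indep x y -> T x x x = 0 -> T y y y = 0 ->
  a * T x x y + b * T x y y = 0 -> a *: x + b *: y != 0 ->
  cls x + cls y + cls (a *: x + b *: y) = h.

Definition cls_locally_constant x :=
  near_vec abv x [set y | T y y y = 0 -> cls y = cls x].

Lemma secant_point_on_surface x y a b : T x x x = 0 -> T y y y = 0 ->
  a * T x x y + b * T x y y = 0 ->
  T (a *: x + b *: y) (a *: x + b *: y) (a *: x + b *: y) = 0.
Proof.
move=> xS yS ab; rewrite (tri_cubic phiC12 phiC23) xS yS.
by transitivity (a * b *+ 3 * (a * T x x y + b * T x y y)); [ring|rewrite ab mulr0].
Qed.

(** If y lies in the tangent plane at x, the line through x and y meets the
   surface at x twice. *)
Lemma cls_tangent x y : indep x y -> T x x x = 0 -> T y y y = 0 -> T x x y = 0 ->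
  cls x + cls y + cls x = h.
Proof.
move=> xy xS yS xxy; have := @cls_secant x y 1 0 xy xS yS.
rewrite scale1r scale0r addr0; apply; last exact: indep_neq0 xy.
by rewrite xxy mulr0 mul0r addr0.
Qed.

Lemma cls_locally_constant_near u : cls_locally_constant u ->
  near_vec abv u [set x | T x x x = 0 -> cls_locally_constant x].
Proof.
move=> uL; apply: filterS2 uL (near_vec_near abvP uL) => x /= xu xL xS.
by apply: filterS xL => y /= yu yS; rewrite yu // xu.
Qed.

(** Projection from the third point V of the line X u maps a neighbourhood of X
   to a neighbourhood of u, and preserves the class up to sign and translation. *)
Lemma cls_locally_constant_secant u X : u != 0 -> T u u u = 0 ->
  X != 0 -> T X X X = 0 -> T X X u != 0 ->
  cls_locally_constant u -> cls_locally_constant X.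
Proof.
move=> u0 uS X0 XS Xu uL.
set a := T X X u in Xu *; pose b := T X u u; pose V := b *: X + (- a) *: u.
have iXu : indep X u.
  apply: contrapT => /(indep_scale X0)[c uE]; move: Xu.
  by rewrite /a uE (triC13 phiC12 phiC23) triZl XS mulr0 eqxx.
have [i [j iX]] := iXu.
have VS : T V V V = 0 by apply: secant_point_on_surface => //; rewrite -/a -/b; ring.
have XXV : T X X V = - a ^+ 2 by rewrite (tri_comb3 phiC12 phiC23) XS -/a; ring.
have XVV : T X V V = - (a ^+ 2 * b).
  rewrite (triC13 phiC12 phiC23) (tri_quad phiC12) XS (triC13 phiC12 phiC23 u u X) -/b.
  by rewrite (triC23 phiC23 X u X) -/a; ring.
pose z x := T x V V *: x + (- T x x V) *: V.
have zX : z X = (- a ^+ 3) *: u.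
  apply/rowP => k; rewrite /z XXV XVV !mxE; ring.
have k0 : - a ^+ 3 != 0 by rewrite oppr_eq0 expf_neq0.
have idX := near_vec_id X.
have cV l : vtends_to (near_vec abv X) (fun=> l) l by exact: vtends_to_cst.
have lz : vtends_to (near_vec abv X) (fun x => (- a ^+ 3)^-1 *: z x) u.
  rewrite -[u in vtends_to _ _ u]scale1r -(mulVf k0) -scalerA -zX.
  apply: vtends_toZ; first exact: tends_to_cst.
  apply: vtends_toD; apply: vtends_toZ => //; first exact: tends_to_tri.
  by apply: tends_toN => //; exact: tends_to_tri.
have lw : tends_to abv (near_vec abv X) (fun x => wedge x V i j) (wedge X V i j).
  exact: tends_to_wedge.
have w0 : wedge X V i j != 0.
  rewrite -[X in wedge X V](addr0 X) -[X in wedge (X + _)]scale1r -(scale0r u) /V wedge_comb.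
  by rewrite mul1r mul0r subr0 mulf_neq0 // oppr_eq0.
have FX : Filter (near_vec abv X) by exact: near_vec_filter.
have nz := @tends_to_near_vec _ _ _ _ _ FX _ _ _ _ lz (near_vec_neq0 u0).
have nL := @tends_to_near_vec _ _ _ _ _ FX _ _ _ _ lz uL.
have key : near_vec abv X [set x | T x x x = 0 -> cls x = h - cls V - cls u].
  (* The points x, V and z x are collinear, and z x is close to a multiple of u. *)
  apply: filterS2 (filterI nz nL) (tends_to_neq0 abvP lw w0) => x [/= zx0 zL] xw xS.
  have z0 : z x != 0 by apply: contraNneq zx0 => ->; rewrite scaler0.
  have ab : T x V V * T x x V + (- T x x V) * T x V V = 0 by ring.
  have zS : T (z x) (z x) (z x) = 0 by exact: secant_point_on_surface.
  have <- : cls (z x) = cls u.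
    rewrite -(@clsZ (- a ^+ 3)^-1 (z x)) ?invr_eq0 //; apply: zL.
    by rewrite triZl (triC12 phiC12) triZl (triC13 phiC12 phiC23) triZl zS !mulr0.
  rewrite -(@cls_secant x V (T x V V) (- T x x V)) //; last by exists i, j.
  by rewrite -/(z x) addrAC addrK addrK.
have XE := near_vec_self abvP key XS.
by apply: filterS key => x /= xE xS; rewrite xE // XE.
Qed.

End ClassFunction.
End CubicSurfaceTopology.

(** * Polynomial identities in characteristic zero *)

Section PolynomialIdentities.
Variable K : fieldType.
Hypothesis natrK : forall n, n.+1%:R != 0 :> K.

Lemma natr_injective : injective (fun n => n%:R : K).
Proof.
have aux m n : (m < n)%N -> m%:R != n%:R :> K.
  move=> mn; rewrite eq_sym -subr_eq0 -natrB 1?ltnW //.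
  by have := natrK (n - m).-1; rewrite prednK // subn_gt0.
move=> m n /eqP mn; have [/aux|/aux|//] := ltngtP m n; first by rewrite mn.
by rewrite eq_sym mn.
Qed.

Lemma poly_eq0_ext (p : {poly K}) : (forall t, p.[t] = 0) -> p = 0.
Proof.
move=> p0; apply/eqP/negPn/negP => pn0.
have /(max_poly_roots pn0) : all (root p) [seq i%:R | i <- iota 0 (size p)].
  by apply/allP => t _; apply/eqP.
by rewrite map_inj_uniq ?iota_uniq ?size_map ?size_iota ?ltnn;
  [move/(_ isT)|exact: natr_injective].
Qed.

Lemma poly_eq0_cofinite (p q : {poly K}) : q != 0 ->
  (forall t, q.[t] != 0 -> p.[t] = 0) -> p = 0.
Proof.
move=> q0 pq; have /eqP : p * q = 0.
  apply: poly_eq0_ext => t; rewrite hornerM.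
  by have [->|/pq ->] := eqVneq q.[t] 0; rewrite ?mulr0 ?mul0r.
by rewrite mulf_eq0 (negPf q0) orbF => /eqP.
Qed.

(** The difference w of both sides satisfies the same equation and vanishes at t;
   in characteristic 0, comparing the orders of vanishing at t forces w = 0. *)
Lemma wronskian_eq0 (u v : {poly K}) (t : K) : v.[t] != 0 ->
  u^`() * v = u * v^`() -> u = (u.[t] / v.[t]) *: v.
Proof.
move=> vt uv; apply/eqP; rewrite -subr_eq0; set w := u - _.
have wv : w^`() * v = w * v^`().
  by rewrite derivB derivZ !mulrBl uv -!scalerAl [v * _]mulrC.
have wt : w.[t] = 0 by rewrite hornerD hornerN hornerZ divfK // subrr.
apply/negPn/negP => w0.
have [[|m] [g gt wE]] := multiplicity_XsubC w t.
  by move: gt; rewrite w0 /= /root; move: wt; rewrite wE expr0 mulr1 => ->; rewrite eqxx.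
move: gt; rewrite w0 /= => gt; pose L := 'X - t%:P.
have LN0 : L ^+ m != 0 by rewrite expf_neq0 // polyXsubC_eq0.
have wvL : (g^`() * L + g *+ m.+1) * v = g * L * v^`().
  apply: (mulfI LN0); move: wv; rewrite wE derivM deriv_exp derivXsubC mul1r -/L /= exprS => wv.
  transitivity ((g^`() * (L * L ^+ m) + g * (L ^+ m *+ m.+1)) * v); last by rewrite wv; ring.
  ring.
have := congr1 (horner^~ t) wvL.
rewrite !hornerM hornerD hornerM hornerMn /L hornerXsubC subrr !(mulr0, mul0r) add0r.
by move/eqP; rewrite mulf_eq0 (negPf vt) orbF -mulr_natr mulf_eq0 (negPf (natrK m)) orbF;
  apply/negP.
Qed.

End PolynomialIdentities.

(** * Tangent sections *)

Section TangentResidual.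
Variables (n : nat) (A : comNzRingType) (phi : 'I_n -> 'I_n -> 'I_n -> A).
Hypotheses (phiC12 : forall i j k, phi i j k = phi j i k)
  (phiC23 : forall i j k, phi i j k = phi i k j).
Local Notation T := (tri phi).

(** The third intersection point of the surface with the line through P with
   tangent direction W. *)
Definition tangent_residual (P W : 'rV[A]_n) : 'rV[A]_n :=
  T W W W *: P + (- (T P W W *+ 3)) *: W.

Variables P W : 'rV[A]_n.
Hypotheses (PS : T P P P = 0) (PW : T P P W = 0).
Local Notation r := (tangent_residual P W).

Lemma tangent_residual_on_surface : T r r r = 0.
Proof. by rewrite (tri_cubic phiC12 phiC23) PS PW; ring. Qed.

Lemma tangent_residual_in_plane : T P P r = 0.
Proof. by rewrite (tri_comb3 phiC12 phiC23) PS PW; ring. Qed.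

Lemma tangent_residual_polar : T r r P = T P W W ^+ 3 *+ 9.
Proof.
rewrite (tri_quad phiC12) PS (triC23 phiC23 P W P) PW (triC13 phiC12 phiC23 W W P); ring.
Qed.

End TangentResidual.

Section PolynomialCurves.
Variables (n : nat) (K : fieldType) (phi : 'I_n -> 'I_n -> 'I_n -> K).

Definition phiX (i j k : 'I_n) : {poly K} := (phi i j k)%:P.
Definition vecC (v : 'rV[K]_n) : 'rV[{poly K}]_n := map_mx polyC v.
Definition veval (t : K) (x : 'rV[{poly K}]_n) : 'rV[K]_n := map_mx (horner_eval t) x.
Definition vderiv (x : 'rV[{poly K}]_n) : 'rV[{poly K}]_n := map_mx (@deriv K) x.

Lemma horner_tri t x y z :
  (tri phiX x y z).[t] = tri phi (veval t x) (veval t y) (veval t z).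
Proof.
rewrite -/(horner_eval t _) tri_rmorph; congr (tri _ _ _ _).
by do 3!apply/funext => ?; rewrite /= /phiX /horner_eval hornerC.
Qed.

Lemma veval_vecC t v : veval t (vecC v) = v.
Proof. by apply/rowP => i; rewrite !mxE /horner_eval hornerC. Qed.

Lemma veval_comb t a b x y :
  veval t (a *: x + b *: y) = a.[t] *: veval t x + b.[t] *: veval t y.
Proof. by apply/rowP => i; rewrite !mxE /horner_eval hornerD !hornerM. Qed.

Lemma veval_tangent_residual t x y :
  veval t (tangent_residual phiX x y) = tangent_residual phi (veval t x) (veval t y).
Proof. by rewrite veval_comb hornerN hornerMn !horner_tri. Qed.

Lemma deriv_tri x y z : (tri phiX x y z)^`() =
  tri phiX (vderiv x) y z + tri phiX x (vderiv y) z + tri phiX x y (vderiv z).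
Proof.
rewrite /tri -!big_split raddf_sum; apply: eq_bigr => i _ /=.
rewrite -!big_split raddf_sum; apply: eq_bigr => j _ /=.
rewrite -!big_split raddf_sum; apply: eq_bigr => k _ /=.
by rewrite !derivM derivC !mxE; ring.
Qed.

Lemma vderiv_vecC v : vderiv (vecC v) = 0.
Proof. by apply/rowP => i; rewrite !mxE derivC. Qed.

End PolynomialCurves.

Section TwoStepTangent.
Variables (R : realType) (K : fieldType) (abv : K -> R).
Hypothesis lcK : locally_compact_char0 abv.
Variable phi : 'I_4 -> 'I_4 -> 'I_4 -> K.
Hypotheses (phiC12 : forall i j k, phi i j k = phi j i k)
  (phiC23 : forall i j k, phi i j k = phi i k j).
Hypothesis smooth : forall (L : fieldType) (f : {rmorphism K -> L}) (x : 'rV[L]_4),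
  x != 0 -> exists i, tri (fun i j k => f (phi i j k)) x x (delta_mx 0 i) != 0.
Local Notation T := (tri phi).
Let abvP := lc_abv lcK.
Let natrK := lc_natr lcK.

Lemma tri0 x y : T 0 x y = 0.
Proof. by rewrite -(scale0r 0) triZl mul0r. Qed.

Section TangentCurve.
Variables P A B : 'rV[K]_4.
Hypotheses (PS : T P P P = 0) (PA : T P P A = 0) (PB : T P P B = 0).
Hypothesis PAA : T P A A != 0.
Hypothesis Bfree : forall a b, B <> a *: P + b *: A.

(** The rational parametrization of the singular cubic cut out by the tangent
   plane at P, by the slope of the lines through P. *)
Definition pencil : 'rV[{poly K}]_4 := 1 *: vecC A + 'X *: vecC B.
Definition curve : 'rV[{poly K}]_4 := tangent_residual (phiX phi) (vecC P) pencil.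
Definition dir (t : K) : 'rV[K]_4 := A + t *: B.
Definition curve_pt (t : K) : 'rV[K]_4 := tangent_residual phi P (dir t).
Definition polar (Y : 'rV[K]_4) : {poly K} := tri (phiX phi) curve curve (vecC Y).

Lemma veval_curve t : veval t curve = curve_pt t.
Proof.
by rewrite veval_tangent_residual veval_comb !veval_vecC hornerX hornerC scale1r.
Qed.

Lemma polarE Y t : (polar Y).[t] = T (curve_pt t) (curve_pt t) Y.
Proof. by rewrite horner_tri veval_curve veval_vecC. Qed.

Lemma dir_tangent t : T P P (dir t) = 0.
Proof.
by rewrite /dir -[A]scale1r (tri_comb3 phiC12 phiC23) PA PB !mulr0 addr0.
Qed.

Lemma point_on_surface t : T (curve_pt t) (curve_pt t) (curve_pt t) = 0.
Proof. exact/tangent_residual_on_surface/dir_tangent. Qed.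

Lemma point_in_plane t : T P P (curve_pt t) = 0.
Proof. exact/tangent_residual_in_plane/dir_tangent. Qed.

Lemma point_polar t : T (curve_pt t) (curve_pt t) P = T P (dir t) (dir t) ^+ 3 *+ 9.
Proof. exact/tangent_residual_polar/dir_tangent. Qed.

Definition quad : {poly K} := tri (phiX phi) (vecC P) pencil pencil.

Lemma quadE t : quad.[t] = T P (dir t) (dir t).
Proof.
by rewrite horner_tri veval_comb !veval_vecC hornerX hornerC scale1r.
Qed.

Lemma quad0 : quad.[0] = T P A A.
Proof. by rewrite quadE /dir scale0r addr0. Qed.

Lemma polarP_neq0 t : quad.[t] != 0 -> (polar P).[t] != 0.
Proof.
rewrite quadE polarE point_polar => q0.
by rewrite -mulr_natr mulf_neq0 ?(natrK 8) // expf_neq0.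
Qed.

Lemma indep_point t : P != 0 -> quad.[t] != 0 -> indep P (curve_pt t).
Proof.
move=> P0 qt; apply: contrapT => /(indep_scale P0)[c cE].
have := polarP_neq0 qt; rewrite polarE cE triZl (triC12 phiC12) triZl PS !mulr0.
by rewrite eqxx.
Qed.

(** If the tangent plane were constant along the curve, the curve would lie in its
   intersection with the tangent plane at P, hence be a line along which the
   surface has a constant tangent plane. *)
Lemma tangent_plane_varies_on_curve : P != 0 -> exists t Y, quad.[t] != 0 /\
  (polar Y)^`().[t] * (polar P).[t] != (polar Y).[t] * (polar P)^`().[t].
Proof.
move=> P0; apply: contrapT => const.
have q00 : quad.[0] != 0 by rewrite quad0.
have qn0 : quad != 0 by apply: contraNneq q00 => ->; rewrite horner0.
(* The linear form of the constant tangent plane, normalized by k P = 1. *)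
pose k Y := (polar Y).[0] / (polar P).[0].
have kP : k P = 1 by rewrite /k divff ?polarP_neq0.
have kL a b x y : k (a *: x + b *: y) = a * k x + b * k y.
  by rewrite /k !polarE (tri_comb3 phiC12 phiC23); ring.
have polark Y : polar Y = k Y *: polar P.
  apply: (wronskian_eq0 natrK); first exact: polarP_neq0.
  apply/eqP; rewrite -subr_eq0; apply/eqP/(poly_eq0_cofinite natrK qn0) => t qt.
  rewrite hornerD hornerN !hornerM; apply/eqP; rewrite subr_eq0.
  by apply/negPn/negP => h; apply: const; exists t, Y.
have kpol Y t : T (curve_pt t) (curve_pt t) Y = k Y * (quad.[t] ^+ 3 *+ 9).
  by rewrite -polarE polark hornerZ polarE point_polar quadE.
(* The line cut out by k on the tangent plane at P is spanned by A0 and B0; the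
   point of the curve of slope t is proportional to W0 t. *)
pose A0 := 1 *: A + (- k A) *: P; pose B0 := 1 *: B + (- k B) *: P.
pose W0 t := 1 *: A0 + t *: B0.
have nine0 : 9%:R != 0 :> K by exact: (natrK 8).
have key t Y : quad.[t] != 0 -> T (W0 t) (W0 t) Y = k Y * T P (dir t) (dir t).
  move=> qt; have kpt : k (curve_pt t) = 0.
    have := kpol (curve_pt t) t; rewrite point_on_surface => /esym/eqP.
    have n0 : quad.[t] ^+ 3 *+ 9 != 0 by rewrite -mulr_natr mulf_neq0 // expf_neq0.
    by rewrite mulf_eq0 (negPf n0) orbF => /eqP.
  move: (kpt); rewrite kL kP mulr1 => /eqP; rewrite addr_eq0 => /eqP cE.
  have kdir : k (dir t) = k A + t * k B.
    by rewrite /dir -[A in A + _]scale1r kL mul1r.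
  have pE : curve_pt t = (- (T P (dir t) (dir t) *+ 3)) *: W0 t + 0 *: P.
    apply/rowP => i; rewrite /curve_pt /tangent_residual cE kdir /W0 /A0 /B0 /dir !mxE; ring.
  have := kpol Y t; rewrite {1 2}pE (tri_quad phiC12) quadE => h.
  have q20 : T P (dir t) (dir t) ^+ 2 * 9%:R != 0.
    by rewrite mulf_neq0 // expf_neq0 // -quadE.
  by apply: (mulfI q20); transitivity (k Y * (T P (dir t) (dir t) ^+ 3 *+ 9)); [rewrite -h|];
    ring.
have coefs Y : [/\ T A0 A0 Y = T P A A * k Y, T A0 B0 Y = T P A B * k Y
    & T B0 B0 Y = T P B B * k Y].
  pose a := T A0 A0 Y - T P A A * k Y; pose b := T A0 B0 Y - T P A B * k Y.
  pose c := T B0 B0 Y - T P B B * k Y.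
  have G0 : a%:P + (b *+ 2) *: 'X + c *: 'X^2 = 0.
    apply: (poly_eq0_cofinite natrK qn0) => t qt.
    rewrite !(hornerD, hornerZ, hornerX, hornerXn, hornerC).
    have PE : T P (dir t) (dir t) = T P A A + t * T P A B *+ 2 + t ^+ 2 * T P B B.
      have -> : dir t = 1 *: A + t *: B by rewrite scale1r.
      by rewrite !(tri_comb2 phiC12) !(tri_comb3 phiC12 phiC23) (triC23 phiC23 P B A); ring.
    have := key t Y qt; rewrite /W0 (tri_quad phiC12) PE => /eqP.
    by rewrite -subr_eq0 => /eqP h; rewrite -[RHS]h /a /b /c; ring.
  have h i := congr1 (fun p : {poly K} => p`_i) G0.
  have := h 0%N; have := h 1%N; have := h 2%N.
  rewrite !coefD !coefZ !coefC !coefX !coefXn ?coef0 /= !(mulr0, mulr1, addr0, add0r).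
  move=> c0 /eqP; rewrite -mulr_natr mulf_eq0 (negPf (natrK 1)) orbF => /eqP b0 a0.
  by split; apply/eqP; rewrite -subr_eq0; apply/eqP.
apply: (@tangent_plane_varies K phi phiC12 smooth A0 B0 k (T P A A) (T P A B) (T P B B)).
- have A00 : A0 != 0.
    apply/eqP => /rowP A00; have AE : A = k A *: P.
      apply/rowP => i; have := A00 i; rewrite !mxE mul1r mulNr => /eqP.
      by rewrite subr_eq0 => /eqP.
    move: PAA; rewrite AE (triC12 phiC12) triZl (triC13 phiC12 phiC23) triZl PS !mulr0.
    by rewrite eqxx.
  apply: contrapT => /(indep_scale A00)[c BE].
  apply: (Bfree (a := k B - c * k A) (b := c)); apply/rowP => i.
  have /rowP/(_ i) := BE; rewrite !mxE mul1r => h.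
  by rewrite -[LHS](subrK (k B * P 0 i)) -[B 0 i - _]addr0 -mulNr addr0 h; ring.
- by move=> v; have [] := coefs v.
- by move=> v; have [] := coefs v.
- by move=> v; have [] := coefs v.
Qed.

End TangentCurve.
End TwoStepTangent.

(** * Local constancy of class functions *)

Section LocalConstancy.
Variables (R : realType) (K : fieldType) (abv : K -> R).
Hypothesis lcK : locally_compact_char0 abv.
Variable phi : 'I_4 -> 'I_4 -> 'I_4 -> K.
Hypotheses (phiC12 : forall i j k, phi i j k = phi j i k)
  (phiC23 : forall i j k, phi i j k = phi i k j).
Hypothesis smooth : forall (L : fieldType) (f : {rmorphism K -> L}) (x : 'rV[L]_4),
  x != 0 -> exists i, tri (fun i j k => f (phi i j k)) x x (delta_mx 0 i) != 0.
Local Notation T := (tri phi).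
Let abvP := lc_abv lcK.
Let natrK := lc_natr lcK.

(** Y itself is suitable unless it is an asymptotic direction; then so is a
   combination of Y and D. *)
Lemma exists_transverse_direction (Q D Y : 'rV[K]_4) :
  T Q Q D = 0 -> T Q Q Y = 0 -> T D Q Y != 0 ->
  exists W, [/\ T Q Q W = 0, T D Q W != 0 & T Q W W != 0].
Proof.
move=> QD QY DY; have [QYY|] := eqVneq (T Q Y Y) 0; last by exists Y.
have two0 : 2%:R != 0 :> K by exact: (natrK 1).
have three0 : 3%:R != 0 :> K by exact: (natrK 2).
have comb l : [/\ T Q Q (1 *: Y + l *: D) = 0,
    T D Q (1 *: Y + l *: D) = T D Q Y + l * T D Q D
  & T Q (1 *: Y + l *: D) (1 *: Y + l *: D) = l * (T D Q Y * 2%:R + l * T D Q D)].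
  split; rewrite ?(tri_comb2 phiC12) !(tri_comb3 phiC12 phiC23) ?QD ?QY ?QYY ?mulr0 ?addr0
    ?mul1r //.
  rewrite (triC23 phiC23 Q Y D) (triC12 phiC12 Q D Y) (triC12 phiC12 Q D D); ring.
have [DD|DD] := eqVneq (T D Q D) 0.
  have [c1 c2 c3] := comb 1; exists (1 *: Y + 1 *: D).
  by rewrite c1 c2 c3 DD !mulr0 !addr0 mul1r mulf_neq0.
have l0 : T D Q Y / T D Q D != 0 by rewrite mulf_neq0 // invr_eq0.
have [c1 c2 c3] := comb (T D Q Y / T D Q D).
exists (1 *: Y + (T D Q Y / T D Q D) *: D); rewrite c1 c2 c3 divfK //; split=> //.
  by rewrite -mulr2n -mulr_natr mulf_neq0.
rewrite mulf_neq0 // -[X in _ + X]mulr1 -mulrDr mulf_neq0 //.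
by rewrite -[1]/(1%:R) -natrD; exact: (natrK 2).
Qed.

Section ClassFunction.
Variables (A : zmodType) (cls : 'rV[K]_4 -> A) (h : A).
Hypothesis clsZ : forall c x, c != 0 -> x != 0 -> T x x x = 0 -> cls (c *: x) = cls x.
Hypothesis cls_secant : forall x y a b, indep x y -> T x x x = 0 -> T y y y = 0 ->
  a * T x x y + b * T x y y = 0 -> a *: x + b *: y != 0 ->
  cls x + cls y + cls (a *: x + b *: y) = h.

(** The points reached from P by two successive tangents form, near one of
   them, a neighbourhood in the surface: if x0 lies in the tangent plane at the
   point Q(t0) of the tangent section at P, the condition that x lies in the
   tangent plane at Q(t) is a polynomial equation in t having t0 as a simple
   root for x = x0. *)
Lemma exists_locally_constant_point P : P != 0 -> T P P P = 0 ->
  exists x, [/\ x != 0, T x x x = 0 & cls_locally_constant abv phi cls x].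
Proof.
move=> P0 PS.
have {P P0 PS} [P [W [P0 PS PW PWW]]] := exists_nonflat_point lcK phiC12 phiC23 smooth P0 PS.
have [B PB Bfree] := tangent_complement phiC12 phiC23 P W.
have [t [Y [qt pt]]] :=
  tangent_plane_varies_on_curve lcK phiC12 phiC23 smooth PS PW PB PWW Bfree P0.
pose Q := curve_pt phi P W B; pose q := quad phi P W B.
(* The velocity of the curve at Q(t). *)
pose D : 'rV[K]_4 := veval t (vderiv (curve phi P W B)).
have QS s : T (Q s) (Q s) (Q s) = 0 by exact: point_on_surface.
have curveE s : veval s (curve phi P W B) = Q s by exact: veval_curve.
have polarE' x s : (polar phi P W B x).[s] = T (Q s) (Q s) x by exact: polarE.
have dpolar x : (polar phi P W B x)^`().[t] = T D (Q t) x *+ 2.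
  rewrite /polar deriv_tri vderiv_vecC !hornerD !horner_tri !curveE !veval_vecC -/D.
  have -> : veval t 0 = 0 :> 'rV[K]_4 by apply/rowP => i; rewrite !mxE /horner_eval horner0.
  by rewrite (triC13 phiC12 phiC23 _ _ 0) tri0 addr0 (triC12 phiC12 _ D) mulr2n.
have QD : T (Q t) (Q t) D = 0.
  have curve0 : tri (phiX phi) (curve phi P W B) (curve phi P W B) (curve phi P W B) = 0.
    by apply: (poly_eq0_ext natrK) => s; rewrite horner_tri !curveE QS.
  have := congr1 (fun p : {poly K} => p^`().[t]) curve0.
  rewrite /= deriv_tri deriv0 horner0 !hornerD !horner_tri !curveE -/D.
  rewrite (triC13 phiC12 phiC23 D) (triC23 phiC23 (Q t) D) => /eqP.
  by rewrite -mulr2n -mulrSr -mulr_natr mulf_eq0 (negPf (natrK 2)) orbF => /eqP.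
have DQQ : T D (Q t) (Q t) = 0 by rewrite (triC13 phiC12 phiC23).
pose Y' := T (Q t) (Q t) P *: Y + (- T (Q t) (Q t) Y) *: P.
have QY' : T (Q t) (Q t) Y' = 0 by rewrite (tri_comb3 phiC12 phiC23); ring.
have DY' : T D (Q t) Y' != 0.
  apply: contraNneq pt => DY'; rewrite !dpolar !polarE' -subr_eq0.
  move: DY'; rewrite (tri_comb3 phiC12 phiC23) => DY'.
  by apply/eqP; rewrite -[RHS](mul0rn _ 2) -DY'; ring.
have [V [QV DV QVV]] := exists_transverse_direction QD QY' DY'.
(* With this choice of direction, t is a simple root of the equation for x0. *)
pose x0 := tangent_residual phi (Q t) V.
have x0S : T x0 x0 x0 = 0 by apply: tangent_residual_on_surface.
have Qx0 : T (Q t) (Q t) x0 = 0 by apply: tangent_residual_in_plane.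
have Dx0 : T D (Q t) x0 != 0.
  rewrite (tri_comb3 phiC12 phiC23) DQQ mulr0 add0r mulf_neq0 // oppr_eq0.
  by rewrite -mulr_natr mulf_neq0 // (natrK 2).
have Qt0 : Q t != 0.
  by apply: contraNneq Dx0 => ->; rewrite (triC12 phiC12) tri0.
have [i [j Qx0ij]] : indep (Q t) x0.
  apply: contrapT => /(indep_scale Qt0)[c x0E]; move: Dx0.
  by rewrite x0E (triC13 phiC12 phiC23) triZl (triC13 phiC12 phiC23) DQQ mulr0 eqxx.
have x00 : x0 != 0.
  apply: contraNneq Dx0 => ->; rewrite (triC13 phiC12 phiC23); exact/eqP/tri0.
have fam (x : 'rV[K]_4) s : \sum_i x 0 i * (polar phi P W B (delta_mx 0 i)).[s] = T (Q s) (Q s) x.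
  by rewrite (tri_basis phiC12 phiC23); apply: eq_bigr => k _; rewrite polarE'.
have EE : filter_prod (near_vec abv x0) (near_pt abv t)
    [set z | wedge (Q z.2) z.1 i j != 0 /\ q.[z.2] != 0].
  have lt : tends_to abv (filter_prod (near_vec abv x0) (near_pt abv t)) snd t.
    exact: (tends_to_snd (f := id) (near_pt_id _ t)).
  have lx : vtends_to abv (filter_prod (near_vec abv x0) (near_pt abv t)) fst x0.
    move=> k; exact: (tends_to_fst (f := fun x : 'rV[K]_4 => x 0 k) (near_vec_coord _ x0 k)).
  have cst l : vtends_to abv (filter_prod (near_vec abv x0) (near_pt abv t)) (fun=> l) l.
    exact: vtends_to_cst.
  have ldir : vtends_to abv (filter_prod (near_vec abv x0) (near_pt abv t)) (fun z
    => dir W B z.2) (dir W B t).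
    by apply: vtends_toD => //; apply: vtends_toZ.
  have lq : tends_to abv (filter_prod (near_vec abv x0) (near_pt abv t))
      (fun z => T P (dir W B z.2) (dir W B z.2)) (T P (dir W B t) (dir W B t)).
    exact: tends_to_tri.
  have lQ : vtends_to abv (filter_prod (near_vec abv x0) (near_pt abv t)) (fun z => Q z.2) (Q t).
    apply: vtends_toD => //; apply: vtends_toZ => //; first exact: tends_to_tri.
    by apply: tends_toN => //; exact: tends_toMn.
  apply: filterI; first exact: (tends_to_neq0 abvP (tends_to_wedge lcK i j lQ lx) Qx0ij).
  rewrite quadE in qt.
  by apply: filterS (tends_to_neq0 abvP lq qt) => z /=; rewrite /q quadE.
have key : near_vec abv x0 [set x | T x x x = 0 -> cls x = h - (h - (cls P + cls P)) *+ 2].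
  have al k : tends_to abv (near_vec abv x0) (fun x : 'rV[K]_4 => x 0 k) (x0 0 k).
    exact: near_vec_coord.
  have root0 : \sum_k x0 0 k * (polar phi P W B (delta_mx 0 k)).[t] = 0 by rewrite fam.
  have simple : \sum_k x0 0 k * (polar phi P W B (delta_mx 0 k))^`().[t] != 0.
    under eq_bigr do rewrite dpolar mulrnAr.
    by rewrite sumrMnl -(tri_basis phiC12 phiC23) -mulr_natr mulf_neq0 // (natrK 1).
  apply: filterS (simple_root_persists lcK (E := fun x s
    => wedge (Q s) x i j != 0 /\ q.[s] != 0) al root0 simple EE).
  move=> x [s]; rewrite fam => Qsx [wx qs] xS.
  have iPQ : indep P (Q s) by exact: (indep_point lcK phiC12 phiC23 PS PW PB P0 qs).
  have PPQ : T P P (Q s) = 0 by exact: point_in_plane.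
  have iQx : indep (Q s) x by exists i, j.
  have e1 := cls_tangent cls_secant iPQ PS (QS s) PPQ.
  have e2 := cls_tangent cls_secant iQx (QS s) xS Qsx.
  have -> : h - (cls P + cls P) = cls (Q s).
    by rewrite -[h]e1 [_ + _ + cls P]addrAC [LHS]addrC addKr.
  by rewrite -[h]e2 mulr2n [_ + _ + cls (Q s)]addrAC [RHS]addrC addKr.
exists x0; split=> //; have x0E := near_vec_self abvP key x0S.
by apply: filterS key => x /= xE xS; rewrite xE // x0E.
Qed.

(** The tangent plane at X does not contain a whole open piece of the surface, so
   local constancy somewhere propagates to X along a secant. *)
Lemma cls_locally_constant_everywhere X : X != 0 -> T X X X = 0 ->
  cls_locally_constant abv phi cls X.
Proof.
move=> X0 XS; have [u [u0 uS uL]] := exists_locally_constant_point X0 XS.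
have uL' : near_vec abv u [set x | x != 0 /\ (T x x x = 0 -> cls_locally_constant abv phi cls x)].
  apply: filterI; first exact: near_vec_neq0.
  exact: cls_locally_constant_near.
have [x [[x0 xL] xS Xx]] := near_point_off_plane lcK phiC12 phiC23 smooth u0 uS X0 uL'.
exact: (cls_locally_constant_secant lcK phiC12 phiC23 clsZ cls_secant x0 xS X0 XS Xx (xL xS)).
Qed.

End ClassFunction.
End LocalConstancy.

(** * The polar form of a cubic polynomial *)

Section PolarForm.
Variables (n : nat) (K : fieldType).

Lemma mmap_map_mpoly (S : comNzRingType) (f : {rmorphism K -> S}) (h : 'I_n -> S)
    (p : {mpoly K[n]}) : (map_mpoly f p).@[h] = mmap f h p.
Proof.
rewrite [p]mpolyE; elim/big_ind: _ => [|p1 p2 h1 h2|m _].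
- by rewrite !raddf0.
- by rewrite !raddfD /= h1 h2.
- by rewrite map_mpolyZ mevalZ map_mpolyX mmapZ mmapX mevalX.
Qed.

Lemma mpoly_euler d (p : {mpoly K[n]}) : p \is d.-homog ->
  p *+ d = \sum_i 'X_i * p^`M(i).
Proof.
move=> /dhomogP pd; rewrite {1 2}[p]mpolyE -sumrMnl.
transitivity (\sum_(m <- msupp p) \sum_i p@_m *: ('X_i * ('X_[m])^`M(i))); last first.
  rewrite exchange_big; apply: eq_bigr => i _.
  rewrite [in RHS]raddf_sum mulr_sumr; apply: eq_bigr => m _.
  by rewrite /= mderivZ scalerAr.
rewrite big_seq [RHS]big_seq; apply: eq_bigr => m mp; rewrite -scaler_sumr scalerMnr;
  congr (_ *: _).
have <- : mdeg m = d := pd m mp.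
rewrite mdegE -mulr_natl natr_sum mulr_suml; apply: eq_bigr => i _.
rewrite mderivX -scalerAr -mpolyXD mulr_natl scaler_nat.
have [->|mi] := eqVneq (m i) 0%N; first by rewrite !mulr0n.
by rewrite addmC submK // lep1mP.
Qed.

Lemma dhomog_mderiv d i (p : {mpoly K[n]}) : p \is d.+1.-homog -> p^`M(i) \is d.-homog.
Proof.
move=> /dhomogP pd; rewrite [p]mpolyE raddf_sum big_seq; apply: rpred_sum => m mp /=.
rewrite mderivZ mderivX rpredZ //.
have [mi|mi] := eqVneq (m i) 0%N; first by rewrite mi scale0r rpred0.
rewrite rpredZ // dhomogX /=.
have : mdeg m = d.+1 := pd m mp.
rewrite -{1}(@submK _ U_(i)%MM m) ?lep1mP // mdegD mdeg1 addn1.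
by move=> /eqP; rewrite eqSS.
Qed.

Lemma dhomog0_const (p : {mpoly K[n]}) : p \is 0.-homog -> p = (p@_0%MM)%:MP.
Proof.
move=> /dhomogP p0; apply/mpolyP => m; rewrite mcoeffC.
have [<-|m0] := eqVneq 0%MM m; first by rewrite mulr1.
rewrite mulr0; apply: memN_msupp_eq0; apply: contraNN m0 => /p0 /eqP.
by rewrite mdeg_eq0 eq_sym.
Qed.

Hypothesis natrK : forall m, m.+1%:R != 0 :> K.
Variable F : {mpoly K[n]}.
Hypothesis Fhomog : F \is 3.-homog.

(** The coefficients of the symmetric trilinear form T with F(x) = T(x, x, x). *)
Definition polar_coef (i j k : 'I_n) : K := (F^`M(i)^`M(j)^`M(k))@_0%MM / 6%:R.
Local Notation phi := polar_coef.

Lemma polar_coefC12 i j k : phi i j k = phi j i k.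
Proof. by rewrite /polar_coef [F^`M(i)^`M(j)]mderiv_comm. Qed.

Lemma polar_coefC23 i j k : phi i j k = phi i k j.
Proof. by rewrite /polar_coef mderiv_comm. Qed.

(** Euler's identity, applied to F and to its first and second derivatives. *)
Lemma cubic_polarE : F = \sum_i \sum_j \sum_k phi i j k *: ('X_i * 'X_j * 'X_k).
Proof.
have E : F *+ 6 = \sum_i \sum_j \sum_k (F^`M(i)^`M(j)^`M(k))@_0%MM *: ('X_i * 'X_j * 'X_k).
  rewrite (mulrnA _ 3 2) (mpoly_euler Fhomog) -sumrMnl; apply: eq_bigr => i _.
  rewrite -mulrnAr (mpoly_euler (dhomog_mderiv i Fhomog)) mulr_sumr; apply: eq_bigr => j _.
  have Fij := dhomog_mderiv j (dhomog_mderiv i Fhomog).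
  rewrite -[_^`M(j) in LHS]mulr1n [in LHS](mpoly_euler Fij) !mulr_sumr; apply: eq_bigr => k _.
  rewrite [in LHS](dhomog0_const (dhomog_mderiv k Fij)); move: (_@__) => c.
  by rewrite -mul_mpolyC; ring.
have six : 6%:R != 0 :> K by exact: (natrK 5).
apply: (scalerI six); rewrite scaler_nat E scaler_sumr; apply: eq_bigr => i _.
rewrite scaler_sumr; apply: eq_bigr => j _; rewrite scaler_sumr; apply: eq_bigr => k _.
by rewrite scalerA /polar_coef [6%:R * _]mulrC divfK.
Qed.

Section Evaluation.
Variables (S : comNzRingType) (f : {rmorphism K -> S}) (x : 'rV[S]_n).
Local Notation fphi := (fun i j k => f (phi i j k)).

Lemma mmap_polar : mmap f (x ord0) F = tri fphi x x x.
Proof.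
rewrite [in LHS]cubic_polarE raddf_sum; apply: eq_bigr => i _.
rewrite raddf_sum; apply: eq_bigr => j _; rewrite raddf_sum; apply: eq_bigr => k _.
by rewrite /= mmapZ !rmorphM /= !mmapX !mmap1U !mulrA.
Qed.

Lemma mmap_deriv_polar l :
  mmap f (x ord0) F^`M(l) = tri fphi x x (delta_mx 0 l) *+ 3.
Proof.
have C12 i j k : f (phi i j k) = f (phi j i k) by rewrite polar_coefC12.
have C23 i j k : f (phi i j k) = f (phi i k j) by rewrite polar_coefC23.
have X_l i : mmap f (x ord0) ('X_i)^`M(l) = (delta_mx 0 l : 'rV[S]_n) 0 i.
  rewrite mderivX mmapZ mxE eqxx /= mnm1E eq_sym rmorph_nat.
  have [->|_] := eqVneq i l; last by rewrite mul0r.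
  have -> : (U_(l) - U_(l) = 0)%MM by apply/mnmP => j; rewrite mnmBE mnm0E subnn.
  by rewrite mpolyX0 mul1r rmorph1.
transitivity (tri fphi (delta_mx 0 l) x x + tri fphi x (delta_mx 0 l) x + tri fphi x x
  (delta_mx 0 l)).
  pose g (p : {mpoly K[n]}) := mmap f (x ord0) p^`M(l).
  have gD : {morph g : p q / p + q} by move=> p q; rewrite /g !raddfD.
  have g0 : g 0 = 0 by rewrite /g !raddf0.
  rewrite -/(g F) [in LHS]cubic_polarE -!big_split (big_morph g gD g0); apply: eq_bigr => i _.
  rewrite /= -!big_split (big_morph g gD g0); apply: eq_bigr => j _.
  rewrite /= -!big_split (big_morph g gD g0) /g; apply: eq_bigr => k _ /=.
  rewrite mderivZ !mderivM mmapZ !(rmorphD, rmorphM) /= !X_l !mmapX !mmap1U; ring.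
by rewrite (triC13 C12 C23 (delta_mx 0 l)) (triC23 C23 x (delta_mx 0 l)); ring.
Qed.

End Evaluation.

Lemma meval_polar (x : 'rV[K]_n) : F.@[x ord0] = tri phi x x x.
Proof. exact: (mmap_polar (idfun : {rmorphism K -> K})). Qed.

End PolarForm.

(** By Euler's identity, a point where the gradient vanishes lies on the surface. *)
Lemma smooth_polar (K : preTopologicalFieldType) (F : {mpoly K[4]}) :
  (forall m, m.+1%:R != 0 :> K) -> smooth_cubic F ->
  forall (L : fieldType) (f : {rmorphism K -> L}) (x : 'rV[L]_4), x != 0 ->
  exists i, tri (fun i j k => f (polar_coef F i j k)) x x (delta_mx 0 i) != 0.
Proof.
move=> natrK [Fhomog _ smooth] L f x x0; apply: contrapT => sing.
have xi i : tri (fun i j k => f (polar_coef F i j k)) x x (delta_mx 0 i) = 0.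
  by apply/eqP/negPn/negP => h; apply: sing; exists i.
have Fx : (map_mpoly f F).@[x ord0] = 0.
  rewrite mmap_map_mpoly (mmap_polar natrK Fhomog) tri_basis => [|i j k|i j k].
  - by rewrite big1 // => k _; rewrite xi mulr0.
  - by rewrite polar_coefC12.
  - by rewrite polar_coefC23.
have xnz : exists i, x ord0 i != 0 by apply/rV0Pn.
have [i Fi] := smooth L f (x ord0) xnz Fx; move: Fi.
by rewrite mmap_map_mpoly (mmap_deriv_polar natrK Fhomog) xi mul0rn eqxx.
Qed.

(** * Points and line cycles *)

Section ProjectivePoints.
Variable K : preTopologicalFieldType.
Implicit Types (v : 'rV[K]_4) (P Q : proj3 K).

Definition represents v P : Prop := exists2 c : K, c != 0 & v = c *: coords P.

Lemma coords_neq0 P : coords P != 0.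
Proof. exact: set_mem (valP (repr P)). Qed.

Lemma represents_coords P : represents (coords P) P.
Proof. by exists 1; rewrite ?oner_eq0 // scale1r. Qed.

Lemma represents_neq0 v P : represents v P -> v != 0.
Proof. by move=> [c c0 ->]; rewrite scaler_eq0 negb_or c0 coords_neq0. Qed.

Lemma proportional_repr_eq P Q : proportional (repr P) (repr Q) -> P = Q.
Proof. by move=> /eqmodP; rewrite !reprK. Qed.

Lemma represents_inj v P Q : represents v P -> represents v Q -> P = Q.
Proof.
move=> [c c0 ->] [d d0 E]; apply: proportional_repr_eq; apply/asboolP.
exists (c^-1 * d); first by rewrite mulf_neq0 ?invr_eq0.
by rewrite -scalerA -[d *: _]E scalerA mulVf // scale1r.
Qed.

Lemma represents_scale v P c : c != 0 -> represents v P -> represents (c *: v) P.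
Proof. by move=> c0 [d d0 ->]; exists (c * d); rewrite ?mulf_neq0 // scalerA. Qed.

Lemma represents_pi (u : nonzero_vector K) : represents (val u) (\pi_(proj3 K) u).
Proof.
set P := \pi_(proj3 K) u.
have /asboolP[c c0 cE] : proportional u (repr P) by apply/eqmodP; rewrite reprK.
by exists c.
Qed.

End ProjectivePoints.

Lemma mup_linear (K : fieldType) (d e : K) : (d != 0) || (e != 0) ->
  (d%:P + e *: 'X != 0) /\ mup 0 (d%:P + e *: 'X) = (d == 0) :> nat.
Proof.
have [->|d0] := eqVneq d 0; rewrite ?eqxx /= => e0.
  rewrite add0r -mul_polyC mulf_neq0 ?polyC_eq0 ?polyX_eq0 //; split=> //.
  rewrite mupMr ?rootC // -[X in mup _ X]expr1 -['X]subr0 -polyC0 mup_XsubCX.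
  by rewrite eqxx.
have dr : ~~ root (d%:P + e *: 'X) 0.
  by rewrite /root hornerD hornerC hornerZ hornerX mulr0 addr0.
have dn0 : d%:P + e *: 'X != 0 by apply: contraNneq dr => ->; rewrite root0.
by rewrite mupNroot // (negPf d0).
Qed.

Section Lines.
Variables (K : fieldType) (v w : 'rV[K]_4).
Hypothesis vw : indep v w.

Definition line : {vspace 'rV[K]_4} := (<[v]> + <[w]>)%VS.

Lemma lineP x : reflect (exists a b, x = a *: v + b *: w) (x \in line).
Proof.
apply: (iffP memv_addP) => [[_ /vlineP[a ->] [_ /vlineP[b ->] ->]]|[a [b ->]]].
  by exists a, b.
by exists (a *: v); [exact/vlineP/(ex_intro _ a)|exists (b *: w) => //;
  exact/vlineP/(ex_intro _ b)].
Qed.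

Lemma dim_line : \dim line = 2%N.
Proof.
rewrite dimv_disjoint_sum ?dim_vline ?(indep_neq0 vw) ?(indep_neq0 (indepC vw)) //.
apply/eqP; rewrite -subv0; apply/subvP => x /memv_capP[/vlineP[a ->] /vlineP[b ab]].
have ab0 : a *: v + (- b) *: w = 0 by rewrite scaleNr ab subrr.
by have [-> _] := indep_comb0 vw ab0; rewrite scale0r mem0v.
Qed.

Lemma line_complement_pick x : x != 0 -> x \in line ->
  let y := vpick (line :\: <[x]>)%VS in y \in line /\ indep x y.
Proof.
move=> x0 xl y; have yD : y \in (line :\: <[x]>)%VS by exact: memv_pick.
split; first exact: (subvP (diffvSl _ _)) yD.
have y0 : y != 0.
  rewrite /y vpick0 -dimv_eq0; have := dimv_cap_compl line <[x]>%VS; rewrite dim_line => dE.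
  apply/eqP => D0; move: dE; rewrite D0 addn0 => dE.
  by have := dimvS (capvSr line <[x]>%VS); rewrite dE dim_vline x0.
apply: contrapT => /(indep_scale x0)[c yE].
have : y \in ((line :\: <[x]>) :&: <[x]>)%VS.
  by rewrite memv_cap yD; apply/vlineP; exists c.
by rewrite capv_diff memv0 (negPf y0).
Qed.

End Lines.

Section LineCycles.
Variables (K : preTopologicalFieldType) (F : {mpoly K[4]}).
Hypotheses (natrK : forall m, m.+1%:R != 0 :> K) (Fhomog : F \is 3.-homog).
Local Notation T := (tri (polar_coef F)).

Lemma horner_restrict_line v w t :
  (restrict_line F v w).[t] = T (v + t *: w) (v + t *: w) (v + t *: w).
Proof.
pose x : 'rV[{poly K}]_4 := \row_i ((v ord0 i)%:P + w ord0 i *: 'X).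
have -> : restrict_line F v w = mmap (@polyC K) (x ord0) F.
  by congr mmap; apply/funext => i; rewrite mxE.
rewrite (mmap_polar natrK Fhomog (@polyC K)) horner_tri.
suff -> : veval t x = v + t *: w by [].
by apply/rowP => i; rewrite !mxE /horner_eval hornerD hornerC hornerZ hornerX mulrC.
Qed.

(** On a line the cubic form becomes a binary cubic form; when this splits over K,
   its linear factors give the points of the cycle with their multiplicities.  For
   k = 0 the line lies in the surface. *)
Lemma line_relation_of_factorization v w (p q r : K * K) (k : K)
    (P Q S : surface_points F) :
  indep v w ->
  represents (p.1 *: v + p.2 *: w) (val P) ->
  represents (q.1 *: v + q.2 *: w) (val Q) ->
  represents (r.1 *: v + r.2 *: w) (val S) ->
  (forall a b, let x := a *: v + b *: w in T x x x =
    k * ((a * p.2 - b * p.1) * (a * q.2 - b * q.1) * (a * r.2 - b * r.1))) ->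
  line_relation (<< P >> + << Q >> + << S >>).
Proof.
move=> vw pP qQ rS FE; pose l := line v w; have lP := @lineP K v w.
have online (u : K * K) (X : proj3 K) : represents (u.1 *: v + u.2 *: w) X -> on_line l X.
  move=> [c c0 uE]; rewrite /on_line; have -> : coords X = c^-1 *: (u.1 *: v + u.2 *: w).
    by rewrite uE scalerA mulVf // scale1r.
  by apply: memvZ; apply/lP; exists u.1, u.2.
have [k0|k0] := eqVneq k 0.
  apply: (@LineIn _ _ l); rewrite ?(dim_line vw);
    [by []| |exact: online pP|exact: online qQ|exact: online rS].
  move=> x y /lP[x1 [x2 ->]] /lP[y1 [y2 ->]]; apply: (poly_eq0_ext natrK) => t.
  rewrite horner_restrict_line.
  have -> : x1 *: v + x2 *: w + t *: (y1 *: v + y2 *: w)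
    = (x1 + t * y1) *: v + (x2 + t * y2) *: w.
    by apply/rowP => i; rewrite !mxE; ring.
  by rewrite FE k0 mul0r.
pose lin (x1 x2 y1 y2 : K) (u : K * K) := (x1 * u.2 - x2 * u.1)%:P + (y1 * u.2 - y2 * u.1) *: 'X.
have restrictE x1 x2 y1 y2 : restrict_line F (x1 *: v + x2 *: w) (y1 *: v + y2 *: w)
    = k%:P * (lin x1 x2 y1 y2 p * lin x1 x2 y1 y2 q * lin x1 x2 y1 y2 r).
  apply/eqP; rewrite -subr_eq0; apply/eqP/(poly_eq0_ext natrK) => t.
  rewrite hornerD hornerN horner_restrict_line.
  have -> : x1 *: v + x2 *: w + t *: (y1 *: v + y2 *: w)
    = (x1 + t * y1) *: v + (x2 + t * y2) *: w.
    by apply/rowP => i; rewrite !mxE; ring.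
  rewrite FE !hornerM /lin !(hornerD, hornerZ, hornerX, hornerC); ring.
have nz x1 x2 y1 y2 (u : K * K) X : represents (u.1 *: v + u.2 *: w) X ->
    x1 * y2 - x2 * y1 != 0 -> (x1 * u.2 - x2 * u.1 != 0) || (y1 * u.2 - y2 * u.1 != 0).
  move=> /represents_neq0 u0 det; rewrite -negb_and; apply: contraNN u0 => /andP[/eqP d0 /eqP e0].
  have u1 : u.1 * (x1 * y2 - x2 * y1) = 0.
    transitivity ((x1 * u.2 - x2 * u.1) * y1 - (y1 * u.2 - y2 * u.1) * x1); first ring.
    by rewrite d0 e0 !mul0r subrr.
  have u2 : u.2 * (x1 * y2 - x2 * y1) = 0.
    transitivity ((x1 * u.2 - x2 * u.1) * y2 - (y1 * u.2 - y2 * u.1) * x2); first ring.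
    by rewrite d0 e0 !mul0r subrr.
  move/eqP: u1; move/eqP: u2; rewrite !mulf_eq0 (negPf det) !orbF => /eqP-> /eqP->.
  by rewrite !scale0r addr0.
apply: (@LineNotIn _ _ l); rewrite ?(dim_line vw) //.
  have vl : v \in l by apply/lP; exists 1, 0; rewrite scale1r scale0r addr0.
  have wl : w \in l by apply/lP; exists 0, 1; rewrite scale1r scale0r add0r.
  move=> /(_ v w vl wl).
  rewrite -[v in restrict_line _ v]addr0 -[v in v + 0]scale1r -(scale0r w).
  rewrite -[w in restrict_line _ _ w]add0r -[w in 0 + w]scale1r -(scale0r v) restrictE.
  have det : 1 * 1 - 0 * 0 != 0 :> K by rewrite mul1r mul0r subr0 oner_eq0.
  have [hp _] := mup_linear (nz 1 0 0 1 _ _ pP det).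
  have [hq _] := mup_linear (nz 1 0 0 1 _ _ qQ det).
  have [hr _] := mup_linear (nz 1 0 0 1 _ _ rS det).
  by apply/eqP; rewrite !mulf_neq0 // polyC_eq0.
split; [exact: online pP|exact: online qQ|exact: online rS|] => X Xl.
have [/lP[y1 [y2 y12]] Xy] := line_complement_pick vw (coords_neq0 X) Xl.
rewrite /intersection_mult; set y := vpick _ in y12 Xy *; move: (Xl) => /lP[x1 [x2 x12]].
have det : x1 * y2 - x2 * y1 != 0.
  have [i [j ij]] := Xy; move: ij; rewrite x12 y12 wedge_comb mulf_eq0 negb_or.
  by case/andP.
have eqX (u : K * K) (Y : proj3 K) : represents (u.1 *: v + u.2 *: w) Y ->
    (X == Y) = (x1 * u.2 - x2 * u.1 == 0).
  move=> uY; apply/eqP/eqP => [XY|d0].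
    move: uY; rewrite -XY => -[c c0]; rewrite x12 => uE.
    have uE0 : (u.1 - c * x1) *: v + (u.2 - c * x2) *: w = 0.
      by move/eqP: uE; rewrite -subr_eq0 => /eqP <-; apply/rowP => i; rewrite !mxE; ring.
    have [/eqP h1 /eqP h2] := indep_comb0 vw uE0.
    by move: h1 h2; rewrite !subr_eq0 => /eqP-> /eqP->; ring.
  have nX : ~ indep (coords X) (u.1 *: v + u.2 *: w).
    by rewrite x12 => -[i [j]]; rewrite wedge_comb d0 mul0r eqxx.
  have [c uE] := indep_scale (coords_neq0 X) nX.
  apply: (represents_inj _ uY); rewrite uE; apply: represents_scale (represents_coords X).
  by have := represents_neq0 uY; rewrite uE scaler_eq0 negb_or => /andP[].
have [hp mp] := mup_linear (nz _ _ _ _ _ _ pP det).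
have [hq mq] := mup_linear (nz _ _ _ _ _ _ qQ det).
have [hr mr] := mup_linear (nz _ _ _ _ _ _ rS det).
rewrite x12 y12 restrictE mupMr ?rootC // !mupM ?mulf_neq0 //.
by rewrite mp mq mr (eqX _ _ pP) (eqX _ _ qQ) (eqX _ _ rS).
Qed.

End LineCycles.

(** * Classes of points *)

Section Classes.
Variables (K : preTopologicalFieldType) (F : {mpoly K[4]}).
Hypotheses (natrK : forall m, m.+1%:R != 0 :> K) (Fhomog : F \is 3.-homog).
Local Notation T := (tri (polar_coef F)).
Let phiC12 := polar_coefC12 F.
Let phiC23 := polar_coefC23 F.

Lemma pi_H_SD (D E : G_S F) : \pi_(H_S F) (D + E) = \pi_(H_S F) D + \pi_(H_S F) E.
Proof. exact: Quotient.pi_add. Qed.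

(** Line cycles have degree 3, so the difference of two of them lies in G''. *)
Lemma line_relation_class (D E : G_S F) :
  line_relation D -> line_relation E -> \pi_(H_S F) D = \pi_(H_S F) E.
Proof.
have degr D' : line_relation D' -> deg D' = 3.
  by case=> [l P Q S _ _ _|l P Q S _ _ _ _ _]; rewrite !degD !degU.
have inG D' : line_relation D' -> (D' : G_S F) \in @G_S' K F.
  by move=> D'r; apply/mem_set => X [_ XD]; exact: XD.
move=> Dr Er; apply/eqP; rewrite -Quotient.idealrBE; apply/andP; split.
  by have [_ GB] := G_S'_zmod_closed F; apply: GB; exact: inG.
by rewrite degB !degr // subrr.
Qed.

Lemma line_relation_classD (P Q S : surface_points F) :
  \pi_(H_S F) (<< P >> + << Q >> + << S >>) =
  point_class F P + point_class F Q + point_class F S.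
Proof. by rewrite !pi_H_SD. Qed.

Lemma tri_scale c x : T (c *: x) (c *: x) (c *: x) = c ^+ 3 * T x x x.
Proof.
have := tri_cubic phiC12 phiC23 c 0 x 0; rewrite scale0r addr0 => ->; ring.
Qed.

Lemma exists_surface_point x : x != 0 -> T x x x = 0 ->
  exists P : surface_points F, represents x (val P).
Proof.
move=> x0 xS; pose u : nonzero_vector K := exist _ x (mem_set x0).
pose P := \pi_(proj3 K) u; have xP : represents x P := represents_pi u.
have PF : F.@[coords P ord0] = 0.
  rewrite (meval_polar natrK Fhomog); have [c c0 xE] := xP; apply/eqP.
  by move: xS; rewrite xE tri_scale => /eqP; rewrite mulf_eq0 expf_eq0 (negPf c0).
by exists (exist _ P (mem_set PF)).
Qed.

Lemma represented_on_surface x (P : surface_points F) :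
  represents x (val P) -> T x x x = 0.
Proof.
move=> [c c0 ->]; rewrite tri_scale -(meval_polar natrK Fhomog).
have := set_mem (valP P); rewrite /= => ->; exact: mulr0.
Qed.

(** Total on K^4, so that local constancy can be discussed with coordinates; the
   value off the surface is arbitrary. *)
Definition vec_class (x : 'rV[K]_4) : H_S F :=
  if pselect (exists P : surface_points F, represents x (val P)) is left e
  then point_class F (projT1 (cid e)) else 0.

Lemma vec_classE x (P : surface_points F) :
  represents x (val P) -> vec_class x = point_class F P.
Proof.
move=> xP; rewrite /vec_class; case: pselect => [e|[]]; last by exists P.
by congr point_class; apply/val_inj/(represents_inj _ xP)/(projT2 (cid e)).
Qed.

Lemma vec_classZ c x : c != 0 -> x != 0 -> T x x x = 0 -> vec_class (c *: x) = vec_class x.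
Proof.
move=> c0 x0 xS; have [P xP] := exists_surface_point x0 xS.
by rewrite (vec_classE xP) (vec_classE (represents_scale c0 xP)).
Qed.

(** The restriction of F to s x + t y is 3 s t (s T(x,x,y) + t T(x,y,y)), whose
   third root is (a, b). *)
Lemma vec_class_secant D : line_relation D ->
  forall x y a b, indep x y -> T x x x = 0 -> T y y y = 0 ->
  a * T x x y + b * T x y y = 0 -> a *: x + b *: y != 0 ->
  vec_class x + vec_class y + vec_class (a *: x + b *: y) = \pi_(H_S F) D.
Proof.
move=> Dr x y a b xy xS yS ab z0.
have zS := secant_point_on_surface phiC12 phiC23 xS yS ab.
have [P xP] := exists_surface_point (indep_neq0 xy) xS.
have [Q yQ] := exists_surface_point (indep_neq0 (indepC xy)) yS.
have [S zS'] := exists_surface_point z0 zS.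
rewrite (vec_classE xP) (vec_classE yQ) (vec_classE zS') -line_relation_classD.
apply: line_relation_class => //.
have [k kx ky] : exists2 k, T x x y = k * b & T x y y = - (k * a).
  have [a0|a0] := eqVneq a 0; last first.
    exists (- T x y y / a); last by rewrite divfK // opprK.
    by apply: (mulfI a0); move/eqP: ab; rewrite addr_eq0 => /eqP->; field.
  have b0 : b != 0 by apply: contraNneq z0 => b0; rewrite a0 b0 !scale0r addr0.
  exists (T x x y / b); first by rewrite divfK.
  apply: (mulfI b0); move: ab; rewrite a0 mul0r add0r => ->; ring.
apply: (@line_relation_of_factorization K F natrK Fhomog x y (1, 0) (0, 1) (a, b)
  (- k *+ 3)) => //=.
- by rewrite scale1r scale0r addr0.
- by rewrite scale1r scale0r add0r.
move=> s t; rewrite (tri_cubic phiC12 phiC23) xS yS kx ky; ring.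
Qed.

End Classes.

(** * Finitely many classes *)

Section Compactness.
Variables (R : realType) (K : preTopologicalFieldType) (F : {mpoly K[4]}) (abv : K -> R).
Hypothesis lcK : locally_compact_char0 abv.
Hypothesis hF : smooth_cubic F.
Let abvP := lc_abv lcK.
Let natrK := lc_natr lcK.
Let Fhomog : F \is 3.-homog. Proof. by case: hF. Qed.
Local Notation T := (tri (polar_coef F)).
Let phiC12 := polar_coefC12 F.
Let phiC23 := polar_coefC23 F.
Let smooth := smooth_polar natrK hF.

(** Any tangent line at P, directed by w, will do: F(a x + b w) is divisible by
   b^2, and the remaining factor gives Q, unless the line lies in the surface. *)
Lemma exists_tangent_cycle (P : surface_points F) :
  exists Q : surface_points F, line_relation (<< P >> + << P >> + << Q >>).
Proof.
have xP := represents_coords (val P); set x := coords _ in xP.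
have x0 : x != 0 by exact: coords_neq0.
have xS : T x x x = 0 by exact: represented_on_surface xP.
have [w xw wx] := tangent_complement phiC12 phiC23 x x.
have ixw : indep x w.
  apply: contrapT => /(indep_scale x0)[c wE]; apply: (wx c 0).
  by rewrite scale0r addr0.
have x10 : represents (1 *: x + 0 *: w) (val P) by rewrite scale1r scale0r addr0.
have [/andP[/eqP c0 /eqP q0]|rn0] := boolP ((T w w w == 0) && (T x w w == 0)).
  exists P.
  apply: (@line_relation_of_factorization K F natrK Fhomog x w (1, 0) (1, 0) (1, 0) 0) => //=.
  by move=> a b; rewrite (tri_cubic phiC12 phiC23) xS xw c0 q0; ring.
pose r := (- T w w w, T x w w *+ 3).
have z0 : r.1 *: x + r.2 *: w != 0.
  apply: contraNneq rn0 => /(indep_comb0 ixw)[/= /eqP]; rewrite oppr_eq0 => -> /eqP.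
  by rewrite -mulr_natr mulf_eq0 (negPf (natrK 2)) orbF => ->.
have zS : T (r.1 *: x + r.2 *: w) (r.1 *: x + r.2 *: w) (r.1 *: x + r.2 *: w) = 0.
  by rewrite (tri_cubic phiC12 phiC23) xS xw /r /=; ring.
have [Q zQ] := exists_surface_point natrK Fhomog z0 zS; exists Q.
apply: (@line_relation_of_factorization K F natrK Fhomog x w (1, 0) (1, 0) r 1) => //=.
by move=> a b; rewrite (tri_cubic phiC12 phiC23) xS xw /=; ring.
Qed.

Lemma vec_class_locally_constant x : x != 0 -> T x x x = 0 ->
  near_vec abv x [set y | T y y y = 0 -> vec_class F y = vec_class F x].
Proof.
move=> x0 xS; have [P _] := exists_surface_point natrK Fhomog x0 xS.
have [Q Dr] := exists_tangent_cycle P.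
exact: (cls_locally_constant_everywhere lcK phiC12 phiC23 smooth
  (vec_classZ natrK Fhomog) (vec_class_secant natrK Fhomog Dr)).
Qed.

Lemma exists_normalized_coords (P : surface_points F) :
  exists x : 'rV[K]_4, [/\ represents x (val P), forall i, abv (x 0 i) <= 1 &
    exists i, x 0 i = 1].
Proof.
have := coords_neq0 (val P); set x := coords _ => /rV0Pn[j xj].
case: (@arg_maxP _ _ _ j xpredT (fun i => abv (x 0 i)) isT) => i _ imax.
have xi : x 0 i != 0.
  apply: contraTneq (imax j isT) => ->; rewrite -ltNge (abv0 abvP).
  exact: (abv_gt0 abvP).
exists ((x 0 i)^-1 *: x); split; [|move=> k|exists i].
- by apply: represents_scale (represents_coords _); rewrite invr_eq0.
- rewrite mxE mulrC (abvM abvP) (abvV abvP) ler_pdivrMr ?(abv_gt0 abvP) // mul1r.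
  exact: imax.
- by rewrite mxE mulVf.
Qed.

(** Compactness of S(K): a locally constant function on it takes finitely many
   values, otherwise some ultrafilter on S(K) would avoid all of its fibres,
   in contradiction with local constancy at the limit point. *)
Lemma finitely_many_classes :
  exists s : seq (H_S F), forall P : surface_points F, point_class F P \in s.
Proof.
apply: contrapT => infinite.
pose G : set_system (surface_points F) :=
  [set A | exists s : seq (H_S F), forall P, point_class F P \notin s -> A P].
have GF : ProperFilter G.
  apply: Build_ProperFilter_ex => [A [s sA]|].
    apply: contrapT => A0; apply: infinite; exists s => P.
    by apply/negPn/negP => /sA AP; apply: A0; exists P.
  split=> [|A B [s sA] [t tB]|A B AB [s sA]]; first by exists [::].
  - exists (s ++ t) => P; rewrite mem_cat negb_or => /andP[Ps Pt].
    by split; [exact: sA|exact: tB].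
  - by exists s => P /sA /AB.
have [U [UU GU]] := ultraFilterLemma GF.
have /choice[x xP] := exists_normalized_coords.
have /choice[l xl] i : exists l, tends_to abv U (fun P => x P 0 i) l.
  apply: (@lc_compact _ _ _ lcK _ U UU _ 1).
  by apply: filterE => P /=; have [_ h _] := xP P.
pose y : 'rV[K]_4 := \row_i l i.
have xy : vtends_to abv U x y by move=> i; rewrite mxE.
have [i _ Ui] : exists2 i, i \in enum 'I_4 & U [set P | x P 0 i = 1].
  apply: (@ultra_finite_cover _ _ UU _ _ setT _ _ filterT) => P _.
  by have [_ _ [i xi]] := xP P; exists i; rewrite ?mem_enum.
have yi : y 0 i = 1.
  apply: (tends_to_unique abvP (xy i)).
  apply: (tends_to_near (f := fun=> 1)); last exact: tends_to_cst.
  by apply: filterS Ui => P /= ->.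
have y0 : y != 0 by apply/rV0Pn; exists i; rewrite yi oner_eq0.
have yS : T y y y = 0.
  apply: (tends_to_unique abvP (tends_to_tri lcK (polar_coef F) xy xy xy)).
  apply: (tends_to_near (f := fun=> 0)); last exact: tends_to_cst.
  apply: filterE => P /=; have [h _ _] := xP P.
  by rewrite (represented_on_surface natrK Fhomog h).
have near_y := @tends_to_near_vec _ _ _ _ _ (@filter_filter _ _
  (@ultra_proper _ _ UU)) _ _ _ _ xy (vec_class_locally_constant y0 yS).
have away : U [set P | point_class F P != vec_class F y].
  by apply: GU; exists [:: vec_class F y] => P; rewrite inE.
have [P [/= Py /eqP]] := filter_ex (filterI near_y away); apply.
have [h _ _] := xP P.
by rewrite -(vec_classE h) Py // (represented_on_surface natrK Fhomog h).
Qed.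

End Compactness.

(** * Finiteness of the degree zero part *)

Section FiniteTorsion.

Lemma mulrz_abs_eq0 (V : zmodType) (x : V) (z : int) : x *~ z = 0 -> x *+ `|z|%N = 0.
Proof.
case: (intP z) => [|n|n] //.
by rewrite abszN absz_nat mulrNz => /eqP; rewrite oppr_eq0 => /eqP.
Qed.

(** By the pigeonhole principle two different powers of -2 give the same multiple
   of x. *)
Lemma torsion_of_finite_orbit (V : zmodType) (x : V) (s : seq V) :
  (forall n, x *~ ((- 2) ^+ n) \in s) -> exists2 m, (0 < m)%N & x *+ m = 0.
Proof.
move=> xs; pose t := [seq x *~ ((- 2) ^+ n) | n <- iota 0 (size s).+1].
have tN : ~~ uniq t.
  apply/negP => tu; have ts : {subset t <= s} by move=> y /mapP[n _ ->]; exact: xs.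
  by have := uniq_leq_size tu ts; rewrite size_map size_iota ltnn.
have [i [j [ij xij]]] : exists i j, (i < j)%N /\ x *~ ((- 2) ^+ i) = x *~ ((- 2) ^+ j).
  move: tN; apply: contraNP => noij; rewrite map_inj_in_uniq ?iota_uniq // => i j _ _ eqij.
  by have [ij|ij|//] := ltngtP i j; case: noij; [exists i, j|exists j, i].
exists `|((- 2) ^+ i - (- 2) ^+ j : int)|%N.
  rewrite absz_gt0 subr_eq0; apply: contraTneq ij => /(congr1 absz).
  by rewrite !abszX => /eqP; rewrite eqn_exp2l // => /eqP ->; rewrite ltnn.
by apply: mulrz_abs_eq0; rewrite mulrzBr xij subrr.
Qed.

Lemma finite_torsion_span (V : zmodType) (s : seq V) (N : nat) : (0 < N)%N ->
  (forall d, d \in s -> d *+ N = 0) ->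
  finite_set [set x | exists z : V -> int, x = \sum_(d <- s) d *~ z d].
Proof.
move=> N0; elim: s => [|d s IHs] sN.
  apply: (@sub_finite_set _ _ [set 0]); last exact: finite_set1.
  by move=> x [z ->]; rewrite big_nil.
pose X := [set x | exists z : V -> int, x = \sum_(d <- s) d *~ z d].
have finX : finite_set X by apply: IHs => e es; apply: sN; rewrite inE es orbT.
apply: (@sub_finite_set _ _ [set d *+ k + y | k in `I_N & y in X]); last first.
  exact: (finite_image2 (fun k y => d *+ k + y) (finite_II N) finX).
move=> x [z ->]; rewrite big_cons.
have NZ : (N%:Z != 0) by rewrite eqz_nat -lt0n.
have mZ : (z d %% N%:Z)%Z = `|(z d %% N%:Z)%Z|%N by rewrite gez0_abs // modz_ge0.
exists `|(z d %% N%:Z)%Z|%N; first by rewrite /= -ltz_nat -mZ ltz_pmod // ltz_nat.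
exists (\sum_(e <- s) e *~ z e); first by exists z.
congr (_ + _); rewrite {2}(divz_eq (z d) N%:Z) mulrzDr mulrC mulrzA -pmulrn.
by rewrite sN ?mem_head // mul0rz add0r mZ pmulrn.
Qed.

End FiniteTorsion.

Section FiniteGroup.

Lemma common_exponent (V : zmodType) (s : seq V) :
  (forall d, d \in s -> exists2 m, (0 < m)%N & d *+ m = 0) ->
  exists2 N, (0 < N)%N & forall d, d \in s -> d *+ N = 0.
Proof.
elim: s => [|e s IHs] st; first by exists 1%N.
have [m m0 em] := st e (mem_head _ _).
have [|N N0 sN] := IHs; first by move=> d ds; apply: st; rewrite inE ds orbT.
exists (m * N)%N; first by rewrite muln_gt0 m0.
by move=> d; rewrite inE => /predU1P[->|ds];
  [rewrite mulrnA em mul0rn|rewrite mulnC mulrnA sN // mul0rn].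
Qed.

Lemma span_sum (V : zmodType) (I : Type) (r : seq I) (s : seq V) (e : I -> V) (k : I -> int) :
  uniq s -> (forall i, e i \in s) ->
  exists z : V -> int, \sum_(i <- r) e i *~ k i = \sum_(d <- s) d *~ z d.
Proof.
move=> us es; elim: r => [|i r [z zE]].
  by exists (fun=> 0); rewrite big_nil big1 // => d _; rewrite mulr0z.
exists (fun d => z d + (if d == e i then k i else 0)).
rewrite big_cons zE; under [RHS]eq_bigr do rewrite mulrzDr.
rewrite big_split addrC /= [X in _
  = _ + X](bigD1_seq (e i)) //= eqxx [X in _ + (_ + X)]big1 ?addr0 // => d /negPf ->.
exact: mulr0z.
Qed.

Variables (R : realType) (K : preTopologicalFieldType) (F : {mpoly K[4]}) (abv : K -> R).
Hypotheses (lcK : locally_compact_char0 abv) (hF : smooth_cubic F).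

Lemma pi_H_S_mulz (D : G_S F) k : \pi_(H_S F) (D *~ k) = \pi_(H_S F) D *~ k.
Proof. exact: (raddfMz (\pi_(Quotient.quot (@G_S'' K F)))). Qed.

Lemma pi_H_SE (D : G_S F) :
  \pi_(H_S F) D = \sum_(P <- dom D) point_class F P *~ coeff P D.
Proof.
rewrite -{1}[D]freeg_sumE.
have pi0 : \pi_(H_S F) 0 = 0 by have := pi_H_S_mulz 0 0; rewrite !mulr0z.
rewrite (big_morph _ (@pi_H_SD K F) pi0); apply: eq_bigr => P _.
by rewrite -[coeff P D in LHS]intz -freegU_mulz pi_H_S_mulz.
Qed.

Lemma deg_dom (D : G_S F) : deg D = \sum_(P <- dom D) coeff P D.
Proof.
by rewrite -{1}[D]freeg_sumE raddf_sum; apply: eq_bigr => P _; exact: degU.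
Qed.

(** Passing from P to the residual point of a tangent at P multiplies the
   class 3 [P] - h by -2, so this class is torsion. *)
Lemma class_torsion (P : surface_points F) (h : H_S F) :
  (forall D, line_relation D -> \pi_(H_S F) D = h) ->
  exists2 m, (0 < m)%N & (point_class F P *+ 3 - h) *+ m = 0.
Proof.
move=> hE; have [s sP] := finitely_many_classes lcK hF.
have /choice[f fP] := exists_tangent_cycle lcK hF.
have step Q : point_class F (f Q) *+ 3 - h = (point_class F Q *+ 3 - h) *~ (- 2).
  have := hE _ (fP Q); rewrite line_relation_classD => <-.
  move: (point_class F Q) (point_class F (f Q)) => a b.
  have -> : a *+ 3 - (a + a + b) = a - b.
    by rewrite mulrSr opprD addrA [_ + a - _]addrAC mulr2n subrr add0r.
  by rewrite mulrSr [a + a + b]addrC opprD addrA addrK -mulr2n -mulrnBl mulrNz -mulNrz opprB.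
apply: (@torsion_of_finite_orbit _ _ [seq c *+ 3 - h | c <- s]) => n.
suff -> : (point_class F P *+ 3 - h) *~ (- 2) ^+ n = point_class F (iter n f P) *+ 3 - h.
  by apply/mapP; exists (point_class F (iter n f P)).
by elim: n => [|n IHn]; [rewrite expr0|rewrite iterS step -IHn exprSr mulrzA].
Qed.

(** The group is generated by the differences of classes of points, which are
   finitely many and torsion. *)
Lemma finite_H0_S : finite_set (H0_S F).
Proof.
have [[P0 _]|noP] := pselect (exists P : surface_points F, True); last first.
  apply: (@sub_finite_set _ _ [set 0]); last exact: finite_set1.
  move=> x _ /=; rewrite -[x]reprK pi_H_SE.
  by rewrite big1_seq // => P _; case: noP; exists P.
have [Q0 Dr] := exists_tangent_cycle lcK hF P0.
set h := \pi_(H_S F) (<< P0 >> + << P0 >> + << Q0 >>).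
have hE D : line_relation D -> \pi_(H_S F) D = h by move=> Dr'; exact: line_relation_class.
have [s sP] := finitely_many_classes lcK hF.
pose c0 := point_class F P0.
pose t := undup [seq c - c0 | c <- s & `[< exists P, c = point_class F P >]].
have tP P : point_class F P - c0 \in t.
  by rewrite mem_undup; apply/mapP; exists (point_class F P) => //;
    rewrite mem_filter sP andbT; apply/asboolP; exists P.
have [|N N0 tN] := @common_exponent _ t.
  move=> d; rewrite mem_undup => /mapP[c]; rewrite mem_filter => /andP[/asboolP[P ->] _] ->.
  have [m m0 mP] := class_torsion P hE; have [n n0 nP0] := class_torsion P0 hE.
  exists (3 * (m * n))%N; first by rewrite !muln_gt0 m0 n0.
  rewrite mulrnA mulrnBl -[_ *+ 3](subrK h) -[c0 *+ 3](subrK h) opprD addrACA subrr addr0.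
  by rewrite mulrnBl mulrnA mP mul0rn mulnC mulrnA nP0 mul0rn subrr.
apply: sub_finite_set (finite_torsion_span N0 tN) => x; rewrite /H0_S /= /deg_H => x0.
have [z zE] := span_sum (dom (repr x)) (fun P => coeff P (repr x)) (undup_uniq _) tP.
exists z; rewrite -zE -[x in LHS]reprK pi_H_SE.
transitivity (\sum_(P <- dom (repr x)) (point_class F P - c0) *~ coeff P (repr x)
    + c0 *~ \sum_(P <- dom (repr x)) coeff P (repr x)).
  rewrite mulrz_sumr -big_split; apply: eq_bigr => P _; by rewrite /= -mulrzDl subrK.
by rewrite -deg_dom x0 mulr0z addr0.
Qed.

End FiniteGroup.

(** * Passage to the topology of the surface *)

Section LocallyConstantClass.
Variables (R : realType) (K : preTopologicalFieldType) (F : {mpoly K[4]}) (abv : K -> R).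
Hypotheses (lcK : locally_compact_char0 abv) (topo : abv_induces_topology abv).
Hypothesis hF : smooth_cubic F.
Let abvP := lc_abv lcK.
Let natrK := lc_natr lcK.
Let Fhomog : F \is 3.-homog. Proof. by case: hF. Qed.
Local Notation T := (tri (polar_coef F)).

Lemma near_vec_nbhs (x : 'rV[K]_4) (A : set 'rV[K]_4) : near_vec abv x A -> nbhs x A.
Proof.
move=> [r r0 rA]; exists (fun i j => [set y | abv (x i j - y) < r]).
  by move=> i j; apply/topo; exists r.
by move=> y xy; apply: rA => i; rewrite (abv_distC abvP); exact: xy.
Qed.

(** The condition on homogeneous coordinates is open in K^4 and invariant under
   scaling, hence defines an open set of the quotient P^3(K). *)
Lemma point_class_locally_constant : locally_constant (point_class F).
Proof.
move=> P.
pose B := [set Q : proj3 K | forall S : surface_points F, val S = Q ->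
  point_class F S = point_class F P].
have Bopen : open (B : set (proj3 K)).
  rewrite /open /= /quotient_open openE => u Bu.
  pose W := [set x : 'rV[K]_4 | forall S : surface_points F, represents x (val S) ->
    point_class F S = point_class F P].
  have u0 : val u != 0 by exact: set_mem (valP u).
  have uW : near_vec abv (val u) W.
    have [uS|uS] := eqVneq (T (val u) (val u) (val u)) 0; last first.
      have idu := near_vec_id abv (val u).
      apply: filterS (tends_to_neq0 abvP (tends_to_tri lcK (polar_coef F) idu idu idu) uS).
      by move=> x /= xS S /(represented_on_surface natrK Fhomog)/eqP; rewrite (negPf xS).
    have [S uS'] := exists_surface_point natrK Fhomog u0 uS.
    apply: filterS (vec_class_locally_constant lcK hF u0 uS) => x /= xE S' xS'.
    rewrite -(vec_classE xS') xE ?(represented_on_surface natrK Fhomog xS') //.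
    rewrite (vec_classE uS'); apply: Bu; exact: represents_inj uS' (represents_pi u).
  have Wn : nbhs u (val @^-1` W).
    exact: (@initial_continuous _ _ (val : nonzero_vector K -> 'rV[K]_4) u _ (near_vec_nbhs uW)).
  apply: filterS Wn => u' Wu' S SE; apply: Wu'; rewrite SE; exact: represents_pi.
have PB : nbhs (val P) B.
  by apply: open_nbhs_nbhs; split=> // S /val_inj ->.
have Bn : nbhs P (val @^-1` B).
  exact: (@initial_continuous _ _ (val : surface_points F -> proj3 K) P _ PB).
by apply: filterS Bn => S; apply.
Qed.

End LocallyConstantClass.

Theorem theorem8 (R : realType) (K : preTopologicalFieldType)
    (F : {mpoly K[4]}) (hK : local_field R K) (hF : smooth_cubic F) :
  finite_set (H0_S F) /\ locally_constant (point_class F).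
Proof.
have [abv lcK topo] := local_field_locally_compact hK.
by split; [exact: finite_H0_S lcK hF|exact: point_class_locally_constant lcK topo hF].
Qed.
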